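(* Let $\mathfrak q$ be a finite-dimensional algebraic Lie algebra over $\Bbbk$ and let $\vartheta\in\mathrm{Aut}(\mathfrak q)$ be an automorphism of finite order $m\ge 2$ with fixed-point subalgebra $\mathfrak q_0$. Assume that $\mathfrak q_0^*\cap\mathfrak q^*_{\mathsf{reg}}\neq\varnothing$. Then: (i) $\{\mathcal Z_\infty^{\mathfrak q_0},\mathcal Z_\infty^{\mathfrak q_0}\}=0$. (ii) The algebra $\mathsf{alg}\langle \mathcal Z,\mathcal Z_\infty^{\mathfrak q_0}\rangle$, generated by $\mathcal Z=\mathcal Z(\mathfrak q,\vartheta)$ and $\mathcal Z_\infty^{\mathfrak q_0}$, is Poisson-commutative (with respect to $\{\,,\,\}$). (iii) $\mathrm{tr.deg}\,\mathcal Z_\infty^{\mathfrak q_0}\le \mathrm{ind}\,\mathfrak q$.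
   Context: $\Bbbk$ is an algebraically closed field of characteristic $0$. $\mathfrak q=\mathrm{Lie}\,Q$ for a connected affine algebraic group $Q$. $\mathcal S(\mathfrak q)=\Bbbk[\mathfrak q^*]$ is the symmetric algebra with the Lie--Poisson bracket $\{\,,\,\}$, determined by $\{x,y\}=[x,y]$ for $x,y\in\mathfrak q$. A subalgebra (for the commutative product) of $\mathcal S(\mathfrak q)$ is Poisson-commutative if the bracket of any two of its elements is $0$. Index and regular elements: for $\xi\in\mathfrak q^*$, $\mathfrak q^\xi=\{x\in\mathfrak q\mid \xi([x,\mathfrak q])=0\}$; $\mathrm{ind}\,\mathfrak q=\min_{\xi\in\mathfrak q^*}\dim\mathfrak q^\xi$; $\mathfrak q^*_{\mathsf{reg}}=\{\xi\in\mathfrak q^*\mid\dim\mathfrak q^\xi=\mathrm{ind}\,\mathfrak q\}$. Grading: $\zeta$ is a primitive $m$-th root of unity, $\mathfrak q_i=\{x\in\mathfrak q\mid\vartheta(x)=\zeta^i x\}$ for $0\le i\le m-1$, so $\mathfrak q=\bigoplus_{i=0}^{m-1}\mathfrak q_i$ and $\mathfrak q_0=\mathfrak q^\vartheta$. The space $\mathfrak q_0^*$ is regarded as the subspace $\mathrm{Ann}(\bigoplus_{i=1}^{m-1}\mathfrak q_i)\subset\mathfrak q^*$. Brackets: for $x\in\mathfrak q_i$, $y\in\mathfrak q_j$ with $0\le i,j\le m-1$, put $[x,y]_0=[x,y]$ if $i+j\le m-1$ and $[x,y]_0=0$ otherwise; put $[x,y]_\infty=[x,y]-[x,y]_0$ (so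 $[x,y]_\infty=[x,y]$ if $i+j\ge m$ and $0$ otherwise). For $t\in\Bbbk$ put $[\,,\,]_t=[\,,\,]_0+t[\,,\,]_\infty$. For $t\in\mathbb P=\Bbbk\cup\{\infty\}$, $[\,,\,]_t$ is a Lie bracket on the vector space $\mathfrak q$; the resulting Lie algebra is $\mathfrak q_{(t)}$, $\{\,,\,\}_t$ is the corresponding Lie--Poisson bracket on $\mathcal S(\mathfrak q)$, and $\mathcal Z_t$ is the Poisson centre of $(\mathcal S(\mathfrak q),\{\,,\,\}_t)$. Note $\mathfrak q_{(1)}=\mathfrak q$. Set $\mathbb P_{\mathsf{reg}}=\{t\in\mathbb P\mid\mathrm{ind}\,\mathfrak q_{(t)}=\mathrm{ind}\,\mathfrak q\}$, and let $\mathcal Z=\mathcal Z(\mathfrak q,\vartheta)$ be the subalgebra of $\mathcal S(\mathfrak q)$ generated by all $\mathcal Z_t$ with $t\in\mathbb P_{\mathsf{reg}}$. The algebra $\mathfrak q_0\subset\mathfrak q$ acts on $\mathcal S(\mathfrak q)$ by the derivations extending the adjoint action $x\mapsto[x,\cdot]$ of $\mathfrak q$; this preserves $\mathcal Z_\infty$, and $\mathcal Z_\infty^{\mathfrak q_0}$ denotes the subalgebra of $\mathfrak q_0$-invariants in $\mathcal Z_\infty$. *)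

(* Defs.v *)
From HB Require Import structures.
From mathcomp Require Import all_boot all_order all_algebra.
From mathcomp Require Import boolp classical_sets.
From mathcomp Require Import mpoly.

Set Implicit Arguments.
Unset Strict Implicit.
Unset Printing Implicit Defensive.

Import GRing.Theory.

Local Open Scope classical_set_scope.
Local Open Scope ring_scope.

Section AffineGroups.
Variable k : closedFieldType.

Definition evalp N (f : {mpoly k[N]}) (x : 'rV[k]_N) : k := f.@[x 0].

Definition polymap N M (f : 'I_M -> {mpoly k[N]}) (x : 'rV[k]_N) : 'rV[k]_M :=
  \row_i evalp (f i) x.

Definition zariski_closed N (X : set 'rV[k]_N) : Prop :=
  exists S : set {mpoly k[N]}, X = [set x | forall f, S f -> evalp f x = 0].

(* An affine variety, embedded as a Zariski closed subset of some k^N, with a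
   group structure given by polynomial maps. Since k is algebraically closed,
   it is determined by its k-points. *)
Record affine_group := AffineGroup {
  ag_dim : nat;
  ag_car : set 'rV[k]_ag_dim;
  ag_mulp : 'I_ag_dim -> {mpoly k[ag_dim + ag_dim]};
  ag_invp : 'I_ag_dim -> {mpoly k[ag_dim]};
  ag_one : 'rV[k]_ag_dim;
  ag_mul := fun x y : 'rV[k]_ag_dim => polymap ag_mulp (row_mx x y);
  ag_inv := polymap ag_invp;
  _ : zariski_closed ag_car;
  _ : ag_car ag_one;
  _ : forall x y, ag_car x -> ag_car y -> ag_car (ag_mul x y);
  _ : forall x, ag_car x -> ag_car (ag_inv x);
  _ : forall x y z, ag_car x -> ag_car y -> ag_car z ->
        ag_mul x (ag_mul y z) = ag_mul (ag_mul x y) z;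
  _ : forall x, ag_car x -> ag_mul ag_one x = x;
  _ : forall x, ag_car x -> ag_mul x ag_one = x;
  _ : forall x, ag_car x -> ag_mul (ag_inv x) x = ag_one;
  _ : forall x, ag_car x -> ag_mul x (ag_inv x) = ag_one
}.

Arguments ag_car : clear implicits.
Arguments ag_mulp : clear implicits.
Arguments ag_one : clear implicits.

Definition zariski_connected N (X : set 'rV[k]_N) : Prop :=
  forall A B : set 'rV[k]_N, zariski_closed A -> zariski_closed B ->
    A `|` B = X -> A `&` B = set0 -> A = set0 \/ B = set0.

Definition ag_tangent (Q : affine_group) : set 'rV[k]_(ag_dim Q) :=
  [set v | forall f : {mpoly k[ag_dim Q]},
     (forall x, ag_car Q x -> evalp f x = 0) ->
     \sum_i v 0 i * evalp f^`M(i) (ag_one Q) = 0].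

(* The commutator of left invariant vector fields: v extends to the field
   (L_v f)(x) = d_y f(xy) (v) at y = 1, and [v, w] f = v (L_w f) - w (L_v f) at 1,
   evaluated here on the coordinate functions f = x_i. *)
Definition ag_bracket (Q : affine_group) (v w : 'rV[k]_(ag_dim Q)) :
    'rV[k]_(ag_dim Q) :=
  \row_i \sum_a \sum_b (v 0 a * w 0 b - w 0 a * v 0 b) *
    evalp ((ag_mulp Q i)^`M(lshift _ a))^`M(rshift _ b)
      (row_mx (ag_one Q) (ag_one Q)).

End AffineGroups.

Arguments ag_car {k} a _.
Arguments ag_tangent {k} Q _.

Section LieAlgebras.
Variables (k : closedFieldType) (q : vectType k).
Implicit Types (br : q -> q -> q) (x y z : q).

Record is_lie_bracket br : Prop := IsLieBracket {
  lie_linearr : forall x, linear (br x);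
  lie_linearl : forall y, linear (br^~ y);
  lie_alt : forall x, br x x = 0;
  lie_jacobi : forall x y z,
    br x (br y z) + br y (br z x) + br z (br x y) = 0
}.

Definition is_algebraic br : Prop :=
  exists (Q : affine_group k) (phi : 'Hom(q, 'rV[k]_(ag_dim Q))),
    [/\ zariski_connected (ag_car Q),
        injective phi,
        range phi = ag_tangent Q &
        forall x y, phi (br x y) = ag_bracket (phi x) (phi y)].

Definition is_lie_aut br (theta : 'End(q)) : Prop :=
  bijective theta /\ forall x y, theta (br x y) = br (theta x) (theta y).

Definition has_order (theta : 'End(q)) (m : nat) : Prop :=
  [/\ (0 < m)%N, forall x, iter m theta x = x &
      forall d, (0 < d)%N -> (forall x, iter d theta x = x) -> (m <= d)%N].

Definition dualv := 'Hom(q, k^o).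

(* q^xi, as the kernel of x |-> xi([x, -]). *)
Definition stab br (xi : dualv) : {vspace q} :=
  lker (linfun (fun x => linfun (fun y => xi (br x y)) : dualv)).

Lemma linfunE (U V : vectType k) (f : U -> V) : linear f -> linfun f =1 f.
Proof.
move=> f_lin x.
pose g := HB.pack_for {linear U -> V} f (GRing.isLinear.Build _ _ _ _ _ f_lin).
exact: (lfunE g x).
Qed.

Lemma mem_stab br (xi : dualv) x : is_lie_bracket br ->
  reflect (forall y, xi (br x y) = 0) (x \in stab br xi).
Proof.
move=> H.
have inE' z : linfun (fun y => xi (br z y) : k^o) =1 (fun y => xi (br z y)).
  by apply: linfunE => a u v; rewrite (lie_linearr H) linearP.
have outE : linfun (fun z => linfun (fun y => xi (br z y)) : dualv) =1
            (fun z => linfun (fun y => xi (br z y))).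
  apply: linfunE => a u v; apply/lfunP => y.
  by rewrite !lfunE /= !lfunE /= !inE' (lie_linearl H) linearP.
rewrite memv_ker outE; apply: (iffP eqP) => [x0 y | x0].
  by rewrite -inE' x0 zero_lfunE.
by apply/lfunP => y; rewrite inE' x0 zero_lfunE.
Qed.

Fact ind_subproof br :
  exists d, `[< exists xi : dualv, \dim (stab br xi) = d >].
Proof. by exists (\dim (stab br 0)); apply/asboolP; exists 0. Qed.

Definition ind br : nat := ex_minn (ind_subproof br).

Definition regular br : set dualv := [set xi | \dim (stab br xi) = ind br].

(* S(q) is the polynomial ring in the elements of the basis vbasis {:q} of q. *)
Definition symalg := {mpoly k[\dim {:q}]}.
Implicit Types F G : symalg.

Definition lin x : symalg := \sum_i coord (vbasis {:q}) i x *: 'X_i.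

Definition pbr br F G : symalg :=
  \sum_i \sum_j F^`M(i) * G^`M(j) *
    lin (br (vbasis {:q})`_i (vbasis {:q})`_j).

Definition pcenter br : set symalg := [set F | forall G, pbr br F G = 0].

Definition pcommutative br (A : set symalg) : Prop :=
  forall F G, A F -> A G -> pbr br F G = 0.

(* The derivation of S(q) extending y |-> [x, y]. *)
Definition adact br x F : symalg :=
  \sum_j F^`M(j) * lin (br x (vbasis {:q})`_j).

Record is_subalg (A : set symalg) : Prop := IsSubalg {
  subalg1 : A 1;
  subalgD : forall F G, A F -> A G -> A (F + G);
  subalgZ : forall (c : k) F, A F -> A (c *: F);
  subalgM : forall F G, A F -> A G -> A (F * G)
}.

Definition gen_alg (A : set symalg) : set symalg := smallest is_subalg A.

Definition alg_indep r (F : r.-tuple symalg) : Prop :=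
  forall P : {mpoly k[r]}, P \mPo F = 0 -> P = 0.

Definition has_indep_family (A : set symalg) (r : nat) : Prop :=
  exists F : r.-tuple symalg, (forall i, A (tnth F i)) /\ alg_indep F.

Definition is_trdeg (A : set symalg) (d : nat) : Prop :=
  has_indep_family A d /\ forall r, has_indep_family A r -> (r <= d)%N.

Lemma lin_linear : linear lin.
Proof.
move=> a x y; rewrite /lin scaler_sumr -big_split; apply: eq_bigr => i _ /=.
by rewrite linearP scalerDl scalerA.
Qed.

HB.instance Definition _ :=
  GRing.isLinear.Build k q {mpoly k[\dim {:q}]} *:%R lin lin_linear.

Lemma lin_basis (i : 'I_(\dim {:q})) : lin (vbasis {:q})`_i = 'X_i.
Proof.
rewrite /lin (bigD1 i) //= coord_free ?(basis_free (vbasisP _)) // eqxx scale1r.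
rewrite big1 ?addr0 // => j /negPf ij.
by rewrite coord_free ?(basis_free (vbasisP _)) // eq_sym ij scale0r.
Qed.

Lemma mderiv_lin i x : (lin x)^`M(i) = (coord (vbasis {:q}) i x)%:MP.
Proof.
rewrite /lin linear_sum /= (bigD1 i) //= mderivZ mderivX mnm1E eqxx scale1r.
have -> : (U_(i) - U_(i) = 0)%MM by apply/mnmP => j; rewrite mnmBE subnn mnm0E.
rewrite mpolyX0 alg_mpolyC big1 ?addr0 // => j /negPf ij.
by rewrite mderivZ mderivX mnm1E ij scale0r scaler0.
Qed.

Lemma adact_lin br x y : is_lie_bracket br ->
  adact br x (lin y) = lin (br x y).
Proof.
move=> H.
have brE := linfunE (lie_linearr H x).
rewrite [in RHS](coord_vbasis (memvf y)) -brE !linear_sum /=.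
apply: eq_bigr => j _.
by rewrite mderiv_lin mul_mpolyC !linearZ /= brE.
Qed.

Lemma pbr_lin br x y : is_lie_bracket br ->
  pbr br (lin x) (lin y) = lin (br x y).
Proof.
move=> H.
have brE := linfunE (lie_linearl H y).
rewrite [in RHS](coord_vbasis (memvf x)) -brE !linear_sum /=.
apply: eq_bigr => i _.
rewrite !linearZ /= brE -adact_lin // /adact -mul_mpolyC mulr_sumr.
by apply: eq_bigr => j _; rewrite mderiv_lin mulrA.
Qed.

Section Grading.
Variables (br : q -> q -> q) (theta : 'End(q)) (m : nat) (zeta : k).

Definition grade (i : 'I_m) : {vspace q} := passmx.leigenspace theta (zeta ^+ i).

Lemma mem_grade i x : (x \in grade i) = (theta x == zeta ^+ i *: x).
Proof. by rewrite memv_ker add_lfunE opp_lfunE scale_lfunE id_lfunE subr_eq0. Qed.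

(* The component in grade i; q is the direct sum of the grades as soon as
   theta^m = 1 and zeta is a primitive m-th root of unity (see gcomp_grade). *)
Definition gcomp (i : 'I_m) (x : q) : q :=
  sumv_pi (\sum_(j < m) grade j)%VS i x.

Lemma gcomp_grade i j x : [pchar k] =i pred0 -> has_order theta m ->
  m.-primitive_root zeta -> x \in grade i -> gcomp j x = if j == i then x else 0.
Proof.
move=> chark [m0 theta_m _] zetaP.
pose h l (u : q) n := zeta ^- (l * n) *: iter n theta u.
pose avg l u := m%:R^-1 *: \sum_(0 <= n < m) h l u n.
have m_neq0 : m%:R != 0 :> k by move/pcharf0P: chark => ->; rewrite -lt0n.
have z0 n : zeta ^+ n != 0.
  apply: expf_neq0; apply/eqP => ze; have /eqP := prim_expr_order zetaP.
  by rewrite ze expr0n gtn_eqF // eq_sym oner_eq0.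
have avg_mem (l : 'I_m) u : avg l u \in grade l.
  rewrite mem_grade; apply/eqP.
  rewrite /avg linearZ /= [RHS]scalerA [_ * m%:R^-1]mulrC -[RHS]scalerA; congr (_ *: _).
  rewrite linear_sum /=.
  transitivity (\sum_(0 <= n < m) zeta ^+ l *: h l u n.+1).
    apply: eq_bigr => n _; rewrite /h linearZ /= scalerA; congr (_ *: _).
    by rewrite mulnS exprD invfM mulrA mulfV ?mul1r.
  have shift M (f : nat -> q) : f M = f 0%N ->
      \sum_(0 <= n < M) f n.+1 = \sum_(0 <= n < M) f n.
    case: M => [|M] fM; first by rewrite !big_nil.
    by rewrite big_nat_recr //= big_nat_recl //= addrC fM.
  rewrite -scaler_sumr; congr (_ *: _); apply: shift.
  rewrite /h theta_m muln0 mulnC exprM (prim_expr_order zetaP) expr1n.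
  by rewrite expr0.
have avg_gr (i1 i2 : 'I_m) u : u \in grade i1 ->
    avg i2 u = if i2 == i1 then u else 0.
  rewrite mem_grade => /eqP uE.
  have iterE n : iter n theta u = zeta ^+ (i1 * n) *: u.
    elim: n => [|n IH]; first by rewrite muln0 scale1r.
    by rewrite iterS IH linearZ /= uE scalerA mulnS addnC exprD.
  have -> : avg i2 u = m%:R^-1 *: ((\sum_(n < m) (zeta ^+ i1 / zeta ^+ i2) ^+ n) *: u).
    rewrite /avg big_mkord scaler_suml; congr (_ *: _); apply: eq_bigr => n _.
    by rewrite /h iterE scalerA mulrC exprMn exprVn -!exprM.
  have [-> | i12] := eqVneq i2 i1.
    rewrite divff // (eq_bigr (fun _ => 1)) => [|n _]; last exact: expr1n.
    by rewrite sumr_const card_ord scalerA mulVf ?scale1r.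
  pose w := zeta ^+ i1 / zeta ^+ i2.
  have w1 : w - 1 != 0.
    rewrite subr_eq0; apply: contra i12 => /eqP.
    move/(canRL (divfK (z0 _))); rewrite mul1r => /eqP.
    by rewrite (eq_prim_root_expr zetaP) !modn_small // eq_sym.
  rewrite -/w; have -> : \sum_(n < m) w ^+ n = 0.
    apply: (mulfI w1); rewrite -subrX1 mulr0 /w exprMn exprVn -!exprM.
    by rewrite ![(_ * m)%N]mulnC !exprM (prim_expr_order zetaP) !expr1n divr1 subrr.
  by rewrite scale0r scaler0.
have prim_sum n : (0 < n < m)%N -> \sum_(l < m) zeta ^- (l * n) = 0.
  move=> /andP[n0 nm]; pose w := zeta ^- n.
  rewrite (eq_bigr (fun l : 'I_m => w ^+ l)) => [|l _]; last first.
    by rewrite /w exprVn -exprM mulnC.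
  have w1 : w - 1 != 0.
    rewrite subr_eq0 /w invr_eq1 -(expr0 zeta) (eq_prim_root_expr zetaP).
    by rewrite mod0n modn_small // -lt0n.
  apply: (mulfI w1); rewrite -subrX1 mulr0 /w exprVn -exprM mulnC exprM.
  by rewrite (prim_expr_order zetaP) expr1n invr1 subrr.
have avg_sum u : \sum_(l < m) avg l u = u.
  rewrite -scaler_sumr exchange_big /= big_ltn // [X in _ + X]big1_seq ?addr0 => [|n].
    rewrite (eq_bigr (fun _ => u)) => [|l _]; last by rewrite /h muln0 invr1 scale1r.
    by rewrite sumr_const card_ord -scaler_nat scalerA mulVf ?scale1r.
  rewrite mem_index_iota => /andP[_ n0m].
  by rewrite /h -scaler_suml prim_sum ?scale0r.
have avg_add l u v : avg l (u + v) = avg l u + avg l v.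
  rewrite /avg -scalerDr -big_split; congr (_ *: _); apply: eq_bigr => n _ /=.
  have iterD : iter n theta (u + v) = iter n theta u + iter n theta v.
    by elim: (n) => // p IH; rewrite !iterS IH linearD.
  by rewrite /h iterD scalerDr.
have avg0 l : avg l 0 = 0 by apply: (addrI (avg l 0)); rewrite -avg_add !addr0.
have gcompE l u : gcomp l u = avg l u.
  have uV : u \in (\sum_(j < m) grade j)%VS.
    by rewrite -[u]avg_sum; apply: memv_sumr => n _; exact: avg_mem.
  have gcomp_mem n : gcomp n u \in grade n by exact: memv_sum_pi.
  rewrite -[u in RHS](sumv_pi_sum erefl uV : \sum_n gcomp n u = u).
  rewrite (big_morph (avg l) (avg_add l) (avg0 l)) (bigD1 l) //=.
  rewrite (avg_gr l) ?gcomp_mem // eqxx big1 ?addr0 // => n nl.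
  by rewrite (avg_gr n) ?gcomp_mem // eq_sym (negPf nl).
by move=> xi; rewrite gcompE (avg_gr i).
Qed.

Definition br0 x y : q :=
  \sum_(i < m) \sum_(j < m | (i + j <= m - 1)%N) br (gcomp i x) (gcomp j y).

Lemma br0E i j x y : [pchar k] =i pred0 -> is_lie_bracket br ->
  has_order theta m -> m.-primitive_root zeta ->
  x \in grade i -> y \in grade j ->
  br0 x y = if (i + j <= m - 1)%N then br x y else 0.
Proof.
move=> chark H theta_m zetaP xi yj; rewrite /br0.
have br0y v : br 0 v = 0 by rewrite -(linfunE (lie_linearl H v)) linear0.
have brx0 u : br u 0 = 0 by rewrite -(linfunE (lie_linearr H u)) linear0.
rewrite (bigD1 i) //= [X in _ + X]big1 => [|l li]; last first.
  by apply: big1 => n _; rewrite (gcomp_grade _ _ _ _ xi) // (negPf li) br0y.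
rewrite addr0 (gcomp_grade _ _ _ _ xi) // eqxx big_mkcond (bigD1 j) //=.
rewrite (gcomp_grade _ _ _ _ yj) // eqxx big1 ?addr0 // => l lj.
by rewrite (gcomp_grade _ _ _ _ yj) // (negPf lj) brx0 if_same.
Qed.

Definition brinf x y : q := br x y - br0 x y.

(* The parameter ranges over P = k + {oo}, with oo represented by None. *)
Definition brt (t : option k) x y : q :=
  if t is Some c then br0 x y + c *: brinf x y else brinf x y.

Definition Preg : set (option k) := [set t | ind (brt t) = ind br].

Definition Zt (t : option k) : set symalg := pcenter (brt t).

Definition Zalg : set symalg := gen_alg (\bigcup_(t in Preg) Zt t).

(* The q_0-invariants, for the action induced by the original bracket. *)
Definition Zinf_inv : set symalg :=
  [set F | Zt None F /\
     forall x, x \in passmx.leigenspace theta 1 -> adact br x F = 0].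

Definition dual0 : set dualv :=
  [set xi | forall (i : 'I_m) x, (0 < i)%N -> x \in grade i -> xi x = 0].

End Grading.

End LieAlgebras.

(* Main.v *)
(* For [xi] in [q^*] let [pi_t] be the form [xi([x, y]_t)]; then
   [{F, G}_t (xi) = pi_t (d_xi F, d_xi G)], and [F] lies in [Z_t] iff [d_xi F] lies in
   [ker pi_t] for all [xi]. Scaling [q_i] by [s^i] identifies [q_(s^m)] with [q], so
   [dim ker pi_t >= ind q] for all [t] other than [0] and [oo]. As [u] tends to [t],
   [ker pi_u] tends to a subspace of the radical of the restriction of [pi_1] to
   [ker pi_t]; hence this radical has dimension at least [ind q]. If [t] is in [P_reg], it is
   for generic [xi] all of [ker pi_t], so [Z_t] is Poisson-commutative. For [t = oo], it is
   contained in [U = {v in ker pi_oo | pi_1(q_0, v) = 0}], which contains [d_xi F] for [F] in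
   [Z_oo^q_0]. At a point of [q_0^*] that is regular in [q^*] one has [U = q^xi], so generically
   [dim U <= ind q]: thus [U] is the radical and is isotropic for [pi_1]. This gives (i), and
   (iii) by the Jacobian criterion. Finally [{Z_t, Z_u} = 0] for [t <> u], since
   [{,}] is a combination of [{,}_t] and [{,}_u]. *)
Require Import Defs.
From mathcomp Require Import all_boot all_order all_algebra.
From mathcomp Require Import boolp classical_sets.
From mathcomp Require Import mpoly.
From mathcomp Require Import zify ring.

Import GRing.Theory.
Local Open Scope classical_set_scope.
Local Open Scope ring_scope.

Set Implicit Arguments.
Unset Strict Implicit.

(** * Ranks in a pencil of matrices *)

Section LinearAlgebra.
Variable k : fieldType.

(** An invertible compression of maximal size. Together with the converse [mxrank_det_factor], it
    turns lower bounds on ranks into the nonvanishing of determinants, which is a polynomial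
    condition. *)
Lemma mxrank_factor1 m n (M : 'M[k]_(m, n)) :
  exists (L : 'M[k]_(\rank M, m)) (R : 'M[k]_(n, \rank M)), L *m M *m R = 1%:M.
Proof.
exists (pinvmx (col_base M)), (pinvmx (row_base M)).
have -> : pinvmx (col_base M) *m M = row_base M.
  rewrite -[X in _ *m X](mulmx_base M) mulmxA mulVpmx ?col_base_full //.
  exact: mul1mx.
by rewrite mulmxVp // row_base_free.
Qed.

Lemma mxrank_det_factor m n r (L : 'M[k]_(r, m)) (M : 'M[k]_(m, n))
  (R : 'M[k]_(n, r)) : \det (L *m M *m R) != 0 -> (r <= \rank M)%N.
Proof.
rewrite -unitfE -unitmxE => /mxrank_unit <-.
exact: leq_trans (mxrankM_maxl _ _) (mxrankM_maxr _ _).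
Qed.

(** In characteristic 0 the elements 0, 1, ..., [size p - 1] are distinct, and they outnumber the
    possible roots of [p]. *)
Lemma poly_neq0_nonroot (p : {poly k}) : [pchar k] =i pred0 -> p != 0 ->
  exists t, p.[t] != 0.
Proof.
move=> chark p0; apply: contrapT => noroot.
pose rs := [seq (i%:R : k) | i <- iota 0 (size p)].
have := @max_poly_roots _ p rs p0; rewrite size_map size_iota ltnn.
move=> H; suff : false by []; apply: H.
  apply/allP => t _; rewrite rootE; apply: contrapT => /negP pt.
  by apply: noroot; exists t.
rewrite map_inj_uniq ?iota_uniq // => i j.
wlog ij : i j / (i <= j)%N => [hw|/eqP].
  by case/orP: (leq_total i j) => ij // ; [exact: hw|move=> /esym /(hw _ _ ij)].
rewrite eq_sym -subr_eq0 -natrB // (iffLR (pcharf0P k) chark) subn_eq0 => ji.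
by apply/eqP; rewrite eqn_leq ij.
Qed.

(* In bases adapted to [ker A] and to a complement, [A + t B] is
   [[t B1, t B2], [t B3, A' + t B4]] with [A'] invertible; divided by [t], the first
   block row makes the minor on a nonsingular submatrix of [B1] a polynomial in [t]
   that does not vanish at [t = 0]. *)
Lemma mxrank_pencil_ge n m (A B : 'M[k]_n) (K : 'M[k]_(m, n)) :
    A^T = - A -> K *m A = 0 ->
  exists2 p : {poly k}, p != 0 & forall t, p.[t] != 0 ->
    (\rank A + \rank (K *m B *m K^T) <= \rank (A + t *: B)%R)%N.
Proof.
move=> At KA.
have AKt : A *m K^T = 0.
  by apply: trmx_inj; rewrite trmx_mul trmxK At mulmxN KA oppr0 trmx0.
have [L1 [R1 E1]] := mxrank_factor1 (K *m B *m K^T).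
have [L2 [R2 E2]] := mxrank_factor1 A.
set r1 := \rank (K *m B *m K^T) in L1 R1 E1 *; set r2 := \rank A in L2 R2 E2 *.
pose X := L1 *m K *m B *m R2; pose Y := L2 *m B *m K^T *m R1.
pose Z := L2 *m B *m R2.
(* The compression of [A + t *: B] after its first block row has been divided by [t]; at [t = 0] it
   is unitriangular by blocks. *)
pose N : 'M[{poly k}]_(r1 + r2) := block_mx 1%:M (map_mx polyC X)
  ('X *: map_mx polyC Y) (1%:M + 'X *: map_mx polyC Z).
pose Nt t : 'M[k]_(r1 + r2) := block_mx 1%:M X (t *: Y) (1%:M + t *: Z).
have evN t : (\det N).[t] = \det (Nt t).
  rewrite -[LHS]/(horner_eval t (\det N)) -det_map_mx; congr (\det _).
  have evC a b (M : 'M[k]_(a, b)) : map_mx (horner_eval t) (map_mx polyC M) = M.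
    by apply/matrixP => i j; rewrite !mxE /horner_eval hornerC.
  rewrite /N map_block_mx map_mxD !map_mxZ !map_mx1 !evC.
  by rewrite /= /horner_eval hornerX.
(* The factor ['X] excludes [t = 0], where the first block row cannot be divided by [t]. *)
exists ('X * \det N).
  rewrite mulf_neq0 ?polyX_eq0 //; apply/eqP => N0; have := evN 0.
  rewrite N0 horner0 /Nt !scale0r addr0 det_ublock !det1 mulr1 => /esym/eqP.
  by rewrite oner_eq0.
move=> t; rewrite hornerM hornerX mulf_eq0 negb_or evN => /andP[t0 Nt0].
rewrite addnC.
apply: (@mxrank_det_factor _ _ _ (col_mx (L1 *m K) L2) _
  (row_mx (K^T *m R1) R2)).
suff -> : col_mx (L1 *m K) L2 *m (A + t *: B) *m row_mx (K^T *m R1) R2 =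
    block_mx (t%:M : 'M_r1) 0 0 (1%:M : 'M_r2) *m Nt t.
  by rewrite det_mulmx mulf_neq0 // det_ublock det1 mulr1 det_scalar expf_neq0.
rewrite /Nt mulmx_block !mul0mx !mul1mx !addr0 !add0r mulmx1 mul_scalar_mx.
rewrite mul_col_mx mul_col_row !mulmxDr !mulmxDl -!scalemxAr -!scalemxAl.
rewrite -!(mulmxA L1 K A) KA mulmx0 !mul0mx !add0r.
rewrite -(mulmxA L2 A) (mulmxA A) AKt mul0mx mulmx0 add0r E2 !mulmxA.
by rewrite -!(mulmxA L1) !mulmxA in E1 *; rewrite E1 scalemx1.
Qed.

(* [rad (B |_ ker A)] has dimension at least [l] by [mxrank_pencil_ge], and lies in the
   left kernel of [row_mx A (B W^T)], whose dimension is at most [l]. *)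
Lemma pencil_isotropic n p l (A B : 'M[k]_n) (W : 'M[k]_(p, n)) (s : seq k)
    (u v : 'rV[k]_n) : [pchar k] =i pred0 -> A^T = - A -> W *m A = 0 ->
    (forall t, t \notin s -> (\rank (A + t *: B)%R + l <= n)%N) ->
    (n <= \rank (row_mx A (B *m W^T)) + l)%N ->
    u *m A = 0 -> u *m B *m W^T = 0 -> v *m A = 0 ->
  u *m B *m v^T = 0.
Proof.
move=> chark At WA rk_le rk_ge uA uBW vA.
pose K := row_base (kermx A).
have KA : K *m A = 0 by apply/sub_kermxP; rewrite eq_row_base.
have subK q (M : 'M[k]_(q, n)) : M *m A = 0 -> (M <= K)%MS.
  by move=> MA; rewrite eq_row_base; apply/sub_kermxP.
have Kfree : row_free K := row_base_free (kermx A).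
clearbody K.
have rk_rad : (\rank A + \rank (K *m B *m K^T) + l <= n)%N.
  have [f f0 rkf] := mxrank_pencil_ge B At KA.
  (* The product makes a nonroot avoid the exceptional values in [s]. *)
  have g0 : f * \prod_(a <- s) ('X - a%:P) != 0.
    by rewrite mulf_neq0 // prodf_seq_neq0; apply/allP => a _; rewrite polyXsubC_eq0.
  have [t] := poly_neq0_nonroot chark g0.
  rewrite hornerM mulf_eq0 negb_or => /andP[/rkf rkft ts].
  apply: leq_trans (rk_le t _); first by rewrite leq_add2r.
  by move: ts; rewrite -[_ == 0]/(root _ t) root_prod_XsubC.
pose rad := kermx (K *m B *m K^T) *m K.
pose U := kermx (row_mx A (B *m W^T)).
have radU : (rad <= U)%MS.
  apply/sub_kermxP; rewrite mul_mx_row.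
  have [D ->] := submxP (subK _ _ WA).
  rewrite /rad -mulmxA KA mulmx0 trmx_mul !mulmxA.
  by rewrite -2!(mulmxA (kermx _)) mulmx_ker mul0mx row_mx0.
(* The radical has dimension at least [l] by [rk_rad] and [U] at most [l] by [rk_ge], so the
   inclusion [radU] is an equality. *)
have Urad : (U <= rad)%MS.
  rewrite -(mxrank_leqif_sup radU) eqn_leq mxrankS //=.
  rewrite [X in (X <= _)%N]mxrank_ker [X in (_ <= X)%N]mxrankMfree //.
  by rewrite [X in (_ <= X)%N]mxrank_ker; have := mxrank_ker A; lia.
have /submxP[a ->] : (u <= rad)%MS.
  apply: submx_trans Urad; apply/sub_kermxP.
  by rewrite mul_mx_row mulmxA uA uBW row_mx0.
have [b ->] := submxP (subK _ _ vA).
rewrite trmx_mul /rad !mulmxA -!(mulmxA a) -2!(mulmxA (kermx _)).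
by rewrite mulmx_ker mul0mx mulmx0.
Qed.

End LinearAlgebra.

(** * Derivatives and generic values of multivariate polynomials *)

Section MultivariatePolynomials.

(** Both sides obey the Leibniz rule in [p], so constants and variables suffice. An arbitrary
    derivation [D] covers both the partial derivatives of a composition and the derivative along a
    line. *)
Lemma mmap_derivation n (R : comNzRingType) (A : comNzRingType)
    (f : {rmorphism R -> A}) (h : 'I_n -> A) (D : A -> A) (p : {mpoly R[n]}) :
    {morph D : x y / x + y} -> (forall x y, D (x * y) = D x * y + x * D y) ->
    (forall c, D (f c) = 0) ->
  D (mmap f h p) = \sum_i mmap f h p^`M(i) * D (h i).
Proof.
move=> DD DM Df.
pose ok p := D (mmap f h p) = \sum_i mmap f h p^`M(i) * D (h i).
have okD p1 p2 : ok p1 -> ok p2 -> ok (p1 + p2).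
  rewrite /ok => e1 e2; rewrite mmapD DD e1 e2 -big_split; apply: eq_bigr => i _.
  by rewrite mderivD mmapD mulrDl.
have okM p1 p2 : ok p1 -> ok p2 -> ok (p1 * p2).
  rewrite /ok => e1 e2; rewrite rmorphM DM /= e1 e2 mulr_suml mulr_sumr -big_split.
  apply: eq_bigr => i _ /=; rewrite mderivM mmapD !rmorphM /=; ring.
have okC c : ok c%:MP.
  by rewrite /ok mmapC Df big1 // => i _; rewrite mderivC mmap0 mul0r.
have okX i : ok 'X_i.
  rewrite /ok (bigD1 i) //= big1 => [|j ji]; last first.
    by rewrite mderivX mnm1E eq_sym (negPf ji) scale0r mmap0 mul0r.
  rewrite mderivX mnm1E eqxx scale1r.
  have -> : (U_(i) - U_(i) = 0)%MM by apply/mnmP => j; rewrite mnmBE subnn mnm0E.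
  by rewrite mpolyX0 rmorph1 mul1r addr0 mmapX mmap1U.
rewrite -/(ok p) [p]mpolyE; apply: (big_ind ok) => // [|m _].
  exact: (okC 0).
rewrite -mul_mpolyC; apply: (okM) => //; rewrite mpolyXE_id.
apply: (big_ind ok) => // [|i _]; first exact: (okC 1).
by elim: (m i) => [|e IH]; [exact: (okC 1)|rewrite exprS; exact: okM].
Qed.

Lemma mderiv_comp n t (R : comNzRingType) (p : {mpoly R[t]})
    (y : t.-tuple {mpoly R[n]}) l :
  (p \mPo y)^`M(l) = \sum_i (p^`M(i) \mPo y) * (tnth y i)^`M(l).
Proof.
apply: (@mmap_derivation _ _ _ (@mpolyC n R) _ (mderiv l)); last exact: mderivC.
- exact: mderivD.
- exact: mderivM.
Qed.

Lemma msize_mderiv_lt n (R : idomainType) (p : {mpoly R[n]}) i :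
  p^`M(i) != 0 -> (msize p^`M(i) < msize p)%N.
Proof.
move=> dp0; rewrite -(mlead_deg dp0).
have := mlead_supp dp0; rewrite mcoeff_msupp mcoeff_deriv => lead0.
have : (mlead p^`M(i) + U_(i))%MM \in msupp p.
  by rewrite mcoeff_msupp; apply: contraNneq lead0 => ->; rewrite mul0rn.
by move/msize_mdeg_lt; rewrite mdegD mdeg1 addn1.
Qed.

(** The derivative has coefficient [m i] times that of [m] at [m - U_(i)], and a positive [m i] is
    nonzero in characteristic 0. *)
Lemma mderiv_eq0_supp n (R : idomainType) (p : {mpoly R[n]}) i m :
  [pchar R] =i pred0 -> p^`M(i) = 0 -> m \in msupp p -> m i = 0%N.
Proof.
move=> charR dp0; rewrite mcoeff_msupp => pm; apply/eqP; rewrite -leqn0 leqNgt.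
apply/negP => mi; have : p^`M(i)@_(m - U_(i)) = 0 by rewrite dp0 mcoeff0.
have mE : (m - U_(i) + U_(i) = m)%MM.
  by rewrite submK //; apply/mnm_lepP => j; rewrite mnm1E; case: eqP => // <-.
move/eqP; rewrite mcoeff_deriv mE -mulr_natr mulf_eq0 (negPf pm) /=.
by rewrite (iffLR (pcharf0P R) charR).
Qed.

(** Induction on the degree: if [p] vanishes everywhere, differentiating along the line through [v]
    in direction [i] shows that every partial derivative vanishes everywhere too. These are then
    zero, and [p] is constant. *)
Lemma mpoly_neq0_eval n (k : fieldType) (p : {mpoly k[n]}) :
  [pchar k] =i pred0 -> p != 0 -> exists v, p.@[v] != 0.
Proof.
move=> chark; have [N] := ubnP (msize p); elim: N p => // N IH p szp p0.
apply: contrapT => nov; have pv v : p.@[v] = 0.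
  by apply/eqP/negPn/negP => pv; apply: nov; exists v.
have dp i : p^`M(i) = 0.
  apply/eqP/negPn/negP => dp0.
  have [|v] := IH _ _ dp0; first exact: leq_trans (msize_mderiv_lt dp0) _.
  case/eqP; pose h j : {poly k} := (v j)%:P + (j == i)%:R *: 'X.
  have hv (p' : {mpoly k[n]}) t :
      (mmap polyC h p').[t] = p'.@[fun j => v j + (j == i)%:R * t].
    rewrite /meval /mmap horner_sum; apply: eq_bigr => m _.
    rewrite hornerM hornerC; congr (_ * _).
    rewrite /mmap1 horner_prod; apply: eq_bigr => j _.
    by rewrite horner_exp /h !hornerE.
  have : mmap polyC h p = 0.
    apply/eqP/negPn/negP => /(poly_neq0_nonroot chark)[t].
    by rewrite hv pv eqxx.
  move/(congr1 (@deriv _)); rewrite (@mmap_derivation _ _ _ polyC _ (@deriv k)).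
  - move/(congr1 (horner^~ 0)); rewrite deriv0 horner0 horner_sum.
    rewrite (bigD1 i) //= big1 => [|j ji]; rewrite hornerM hv.
      rewrite addr0 /h eqxx scale1r derivD derivC derivX add0r hornerC mulr1.
      by move=> E; rewrite -[RHS]E; apply: meval_eq => j; rewrite mulr0 addr0.
    by rewrite /h (negPf ji) scale0r addr0 derivC horner0 mulr0.
  - exact: derivD.
  - exact: derivM.
  - exact: derivC.
have /eqP := pv (fun=> 0); have -> : p = (p@_0%MM)%:MP.
  apply/mpolyP => m; rewrite mcoeffC; have [->|m0] := eqVneq m 0%MM.
    by rewrite mulr1.
  rewrite mulr0; apply/eqP; rewrite mcoeff_eq0; apply: contra m0 => mp.
  by apply/eqP/mnmP => i; rewrite mnm0E; apply: mderiv_eq0_supp mp.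
rewrite mevalC => c0; move/eqP: p0; apply; apply/mpolyP => m.
rewrite mcoeff0; have [->|m0] := eqVneq m 0%MM; first exact/eqP.
apply/eqP; rewrite mcoeff_eq0; apply: contra m0 => mp.
by apply/eqP/mnmP => i; rewrite mnm0E; apply: mderiv_eq0_supp mp.
Qed.

(** Lower semicontinuity of the rank: [h] is a determinant that is 1 at [v0] and whose nonvanishing
    bounds the rank from below. *)
Lemma mxrank_eval_generic n a b (k : fieldType) (N : 'M[{mpoly k[n]}]_(a, b)) v0 :
  exists2 h : {mpoly k[n]}, h != 0 & forall v, h.@[v] != 0 ->
    (\rank (map_mx (meval v0) N) <= \rank (map_mx (meval v) N))%N.
Proof.
have [L [R LNR]] := mxrank_factor1 (map_mx (meval v0) N).
pose h := \det (map_mx (@mpolyC n k) L *m N *m map_mx (@mpolyC n k) R).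
have hE v : h.@[v] = \det (L *m map_mx (meval v) N *m R).
  have evC c d (M : 'M[k]_(c, d)) : map_mx (meval v) (map_mx (@mpolyC n k) M) = M.
    by apply/matrixP => i j; rewrite !mxE mevalC.
  by rewrite /h -det_map_mx !map_mxM !evC.
exists h => [|v]; last by rewrite hE; apply: mxrank_det_factor.
apply: contra_eq_neq (hE v0) => ->.
by rewrite meval0 LNR det1 eq_sym oner_eq0.
Qed.

End MultivariatePolynomials.

(** * Algebraic independence and the Jacobian criterion *)

Section AlgebraicIndependence.
Variable k : fieldType.

Lemma msize_prod_le n t (y : 'I_t -> {mpoly k[n]}) (D : nat) (e : 'I_t -> nat) :
  (forall i, msize (y i) <= D.+1)%N ->
  (msize (\prod_i y i ^+ e i) <= (\sum_i e i * D).+1)%N.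
Proof.
move=> yD; pose ok (p : {mpoly k[n]}) d := (msize p <= d.+1)%N.
have okM p1 p2 d1 d2 : ok p1 d1 -> ok p2 d2 -> ok (p1 * p2) (d1 + d2)%N.
  rewrite /ok; have [->|p10] := eqVneq p1 0; first by rewrite mul0r msize0.
  have [->|p20] := eqVneq p2 0; first by rewrite mulr0 msize0.
  rewrite msizeM // => o1 o2; move: (leq_add o1 o2).
  by rewrite addSn addnS; case: (_ + _)%N.
have ok1 : ok 1 0%N by rewrite /ok msize1.
apply: (big_ind2 ok) => // [p1 d1 p2 d2|i _]; first exact: okM.
by elim: (e i) => // j IH; rewrite exprS mulSn; apply: okM => //; exact: yD.
Qed.

(* Counting: the [N ^ t] monomials in [y] with exponents below [N] lie in a space of
   polynomials of dimension [O(N ^ n)]. *)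
Lemma mpoly_alg_dependent n t (y : t.-tuple {mpoly k[n]}) : (n < t)%N ->
  exists2 P : {mpoly k[t]}, P != 0 & P \mPo y = 0.
Proof.
move=> nt; pose D := (\max_i msize (tnth y i))%N.
(* Chosen so that [(t * D).+1 ^ n < N], whence [(N * (t * D).+1) ^ n < N ^ n.+1 <= N ^ t]. *)
pose N := ((t * D).+1 ^ n).+1.
pose I := {ffun 'I_t -> 'I_N}; pose J := {ffun 'I_n -> 'I_(t * (N * D)).+1}.
pose mI (a : I) : 'X_{1..t} := [multinom (a i : nat) | i < t].
pose mJ (b : J) : 'X_{1..n} := [multinom (b i : nat) | i < n].
pose M : 'M[k]_(#|I|, #|J|) :=
  \matrix_(a, b) ('X_[mI (enum_val a)] \mPo y)@_(mJ (enum_val b)).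
have cardJI : (#|J| < #|I|)%N.
  rewrite !card_ffun !card_ord.
  apply: (@leq_ltn_trans ((N * (t * D).+1) ^ n)).
    have [->|n0] := posnP n; first by rewrite !expn0.
    by rewrite leq_exp2r // mulnS mulnCA -add1n leq_add2r.
  rewrite expnMn; apply: (@leq_trans (N ^ n.+1)); last first.
    by rewrite leq_exp2l // ltnS expn_gt0.
  by rewrite expnSr ltn_mul2l expn_gt0 /= /N ltnSn.
have : kermx M != 0.
  rewrite kermx_eq0 -row_leq_rank -ltnNge.
  exact: leq_ltn_trans (rank_leq_col M) cardJI.
case/rowV0Pn => c /sub_kermxP cM c0.
have mI_inj : injective mI.
  move=> a a' /mnmP E; apply/ffunP => i; apply: val_inj.
  by have := E i; rewrite !mnmE.
exists (\sum_a c 0 a *: 'X_[mI (enum_val a)]).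
  apply: contra c0 => /eqP P0; apply/eqP/rowP => a; rewrite mxE.
  have := congr1 (mcoeff (mI (enum_val a))) P0.
  rewrite mcoeff0 raddf_sum (bigD1 a) //= big1 => [|b ba].
    by rewrite mcoeffZ mcoeffX eqxx mulr1 addr0.
  rewrite mcoeffZ mcoeffX (inj_eq mI_inj) (inj_eq enum_val_inj) (negPf ba).
  by rewrite mulr0.
apply/mpolyP => m; rewrite mcoeff0 (raddf_sum (comp_mpoly y)) raddf_sum /=.
(* Monomials of larger degree occur in none of the products; the columns of [M] account for all the
   others. *)
have [mbig|msmall] := boolP (t * (N * D) < mdeg m)%N.
  apply: big1 => a _; rewrite comp_mpolyZ mcoeffZ comp_mpolyX.
  apply/eqP; rewrite mulf_eq0 mcoeff_eq0 msize_mdeg_ge ?orbT //.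
  apply: leq_trans mbig.
  apply: (leq_trans (@msize_prod_le _ _ _ D _ _)) => [i|].
    by apply: leqW; apply: (leq_bigmax i).
  rewrite ltnS -[X in (_ <= X * _)%N]card_ord -sum_nat_const leq_sum // => i _.
  by rewrite mnmE leq_mul2r ltnW ?orbT.
have mb i : (m i < (t * (N * D)).+1)%N.
  rewrite ltnS leqNgt; apply: contra msmall => /leq_trans; apply.
  by rewrite mdegE (bigD1 i) //= leq_addr.
pose b : J := [ffun i => Ordinal (mb i)].
have mE : mJ b = m by apply/mnmP => i; rewrite mnmE ffunE.
have := congr1 (fun A : 'rV_#|J| => A 0 (enum_rank b)) cM.
rewrite !mxE => E; rewrite -[RHS]E; apply: eq_bigr => a _.
by rewrite comp_mpolyZ mcoeffZ mxE enum_rankK mE.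
Qed.

(** In characteristic 0 such a [P] does not involve the first variable, so 0 may be put in place of
    [a]; what remains is a polynomial in the other [t] variables. *)
Lemma comp_mpoly_mderiv_eq0 n t (P : {mpoly k[t.+1]}) (a : {mpoly k[n]})
    (y : t.-tuple {mpoly k[n]}) : [pchar k] =i pred0 -> P^`M(ord0) = 0 ->
  P \mPo [tuple of a :: y] =
  (P \mPo [tuple of 0 :: [tuple ('X_i : {mpoly k[t]}) | i < t]]) \mPo y.
Proof.
move=> chark dP0; rewrite [X in _ = X \mPo _]comp_mpolyE raddf_sum comp_mpolyE /=.
apply: eq_big_seq => m mP; rewrite comp_mpolyZ rmorph_prod /=; congr (_ *: _).
rewrite !big_ord_recl (mderiv_eq0_supp chark dP0 mP) !expr0 rmorph1.
congr (_ * _); apply: eq_bigr => i _.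
by rewrite !tnthS tnth_mktuple rmorphXn /= comp_mpolyXU -tnth_nth.
Qed.

(* Differentiating a relation [P(a, y) = 0] of minimal degree. *)
Lemma alg_dependent_mderiv n t (a : {mpoly k[n]}) (y : t.-tuple {mpoly k[n]})
    (P : {mpoly k[t.+1]}) : [pchar k] =i pred0 ->
    (forall Q : {mpoly k[t]}, Q \mPo y = 0 -> Q = 0) ->
    P != 0 -> P \mPo [tuple of a :: y] = 0 ->
  exists (g : {mpoly k[n]}) (c : 'I_t -> {mpoly k[n]}), g != 0 /\
    forall l, g * a^`M(l) = \sum_i c i * (tnth y i)^`M(l).
Proof.
move=> chark indep.
have [N] := ubnP (msize P); elim: N P => // N IH P szP P0 Py0.
have [dP0|dP0] := eqVneq (P^`M(ord0)) 0.
  have P'0 := indep _ (etrans (esym (comp_mpoly_mderiv_eq0 a y chark dP0)) Py0).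
  have := comp_mpoly_mderiv_eq0 'X_ord0 [tuple 'X_(lift ord0 i) | i < t] chark dP0.
  rewrite P'0 comp_mpoly0 => E; move: P0; rewrite -E -[X in X != _]comp_mpoly_id.
  case/eqP; congr (_ \mPo _); apply: eq_from_tnth => i.
  rewrite tnth_mktuple; case: (unliftP ord0 i) => [j|] ->.
    by rewrite tnthS tnth_mktuple.
  by rewrite tnth0.
(* A nonzero derivative that vanishes at [(a, y)] is a relation of smaller degree. *)
have [dPy|dPy] := eqVneq (P^`M(ord0) \mPo [tuple of a :: y]) 0.
  by apply: IH dPy => //; exact: leq_trans (msize_mderiv_lt dP0) _.
exists (P^`M(ord0) \mPo [tuple of a :: y]).
exists (fun i => - (P^`M(lift ord0 i) \mPo [tuple of a :: y])); split=> // l.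
have := congr1 (mderiv l) Py0; rewrite mderiv0 mderiv_comp big_ord_recl tnth0.
move/eqP; rewrite addr_eq0 => /eqP ->; rewrite -sumrN; apply: eq_bigr => i _.
by rewrite tnthS mulNr.
Qed.

(** Extend [F] to a maximal independent family [y]. Each variable is then algebraic over [y], so
    that its differential is a combination of those of [y] wherever the denominators [g] do not
    vanish. There the Jacobian matrix of [y] has rank [n]. *)
Lemma alg_indep_jacobian n r (F : r.-tuple {mpoly k[n]}) (h : {mpoly k[n]}) :
    [pchar k] =i pred0 -> (forall P : {mpoly k[r]}, P \mPo F = 0 -> P = 0) ->
    h != 0 ->
  exists2 v, h.@[v] != 0 & row_free (\matrix_(i, j) ((tnth F i)^`M(j)).@[v]).
Proof.
move=> chark indepF h0.
pose indep t (y : t.-tuple {mpoly k[n]}) :=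
  forall P : {mpoly k[t]}, P \mPo y = 0 -> P = 0.
have indep_le t (y : t.-tuple _) : indep _ y -> (t <= n)%N.
  move=> indepy; rewrite leqNgt; apply/negP => /(mpoly_alg_dependent y)[P P0].
  by move/indepy => P0'; rewrite P0' eqxx in P0.
pose ext s := `[< exists z : s.-tuple _, indep _ (cat_tuple z F) >].
have ext0 : exists s, ext s.
  exists 0%N; apply/asboolP; exists [tuple].
  by have -> : cat_tuple [tuple] F = F by exact: val_inj.
have ext_le s : ext s -> (s <= n)%N.
  by case/asboolP => z /indep_le; apply: leq_trans; exact: leq_addr.
have [s /asboolP[z indepz] smax] := ex_maxnP ext0 ext_le.
set y := cat_tuple z F in indepz.
have /choice[g] j : exists gc : {mpoly k[n]} * ('I_(s + r) -> {mpoly k[n]}),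
    gc.1 != 0 /\
    forall l, gc.1 * ('X_j)^`M(l) = \sum_i gc.2 i * (tnth y i)^`M(l).
  apply: contrapT => nogc; suff : ext s.+1 by move/smax; rewrite ltnn.
  apply/asboolP; exists [tuple of 'X_j :: z] => P.
  have -> : cat_tuple [tuple of 'X_j :: z] F = [tuple of 'X_j :: y].
    exact: val_inj.
  move=> Py; apply/eqP/negPn/negP => P0; apply: nogc.
  have [g [c [g0 gc]]] := alg_dependent_mderiv chark indepz P0 Py.
  by exists (g, c).
move=> gP; have hg0 : h * \prod_j (g j).1 != 0.
  by rewrite mulf_neq0 //; apply/prodf_neq0 => j _; have [] := gP j.
have [v] := mpoly_neq0_eval chark hg0.
rewrite mevalM mulf_eq0 negb_or rmorph_prod => /andP[hv /prodf_neq0 gv].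
exists v => //; set JF := (X in row_free X).
pose Jy : 'M[k]_(s + r, n) := \matrix_(i, j) ((tnth y i)^`M(j)).@[v].
have JFE : dsubmx Jy = JF by apply/matrixP => i j; rewrite !mxE tnth_rshift.
have : row_full Jy.
  rewrite -sub1mx; apply/row_subP => j.
  have -> : row j 1%:M = (\row_i ((g j).1.@[v]^-1 * ((g j).2 i).@[v])) *m Jy.
    apply/rowP => l; rewrite !mxE.
    transitivity ((g j).1.@[v]^-1 * ((g j).1 * ('X_j)^`M(l)).@[v]).
      rewrite mevalM mulKf ?gv // mderivX mnm1E mevalZ.
      have [->|jl] := eqVneq j l; last by rewrite mul0r.
      have -> : (U_(l) - U_(l) = 0)%MM by apply/mnmP => i; rewrite mnmBE subnn mnm0E.
      by rewrite mpolyX0 meval1 mulr1.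
    rewrite (gP j).2 raddf_sum mulr_sumr; apply: eq_bigr => i _.
    by rewrite !mxE /= mevalM mulrA.
  exact: submxMl.
(* The rank [n] is at most [s] plus the rank of the rows of [F], while [s + r <= n]; hence these [r]
   rows are free. *)
rewrite /row_full -[Jy]vsubmxK JFE => /eqP rk.
rewrite -row_leq_rank; have := indep_le _ _ indepz.
have := (mxrank_adds_leqif (usubmx Jy) JF).1; rewrite addsmxE rk.
by have := rank_leq_row (usubmx Jy); lia.
Qed.

End AlgebraicIndependence.

(** * Brackets, differentials and Poisson tensors in coordinates *)

Section Brackets.
Variables (k : closedFieldType) (q : vectType k).
Implicit Types (b : q -> q -> q) (x y : q) (xi : dualv q) (F G : symalg q).
Local Notation n := (\dim {:q}).
Local Notation e := (vbasis {:q}).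
Local Notation e_basis := (vbasisP {:q}).

Lemma linear_fun_sum (U V : vectType k) (f : U -> V) (I : Type) (r : seq I)
    (P : pred I) (u : I -> U) : linear f ->
  f (\sum_(i <- r | P i) u i) = \sum_(i <- r | P i) f (u i).
Proof.
move=> /linfunE fE; rewrite -fE linear_sum; apply: eq_bigr => i _; exact: fE.
Qed.

Lemma linear_funZ (U V : vectType k) (f : U -> V) c u : linear f ->
  f (c *: u) = c *: f u.
Proof. by move=> /linfunE fE; rewrite -!fE linearZ. Qed.

Lemma linear_fun0 (U V : vectType k) (f : U -> V) : linear f -> f 0 = 0.
Proof. by move=> /linfunE fE; rewrite -fE linear0. Qed.

Definition bilin b := (forall x, linear (b x)) /\ (forall y, linear (b^~ y)).

Lemma bilin_sum b I (r : seq I) (u : I -> q) J (s : seq J) (w : J -> q) :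
  bilin b -> b (\sum_(i <- r) u i) (\sum_(j <- s) w j) =
             \sum_(i <- r) \sum_(j <- s) b (u i) (w j).
Proof.
move=> [br_ bl]; rewrite (linear_fun_sum _ _ _ (bl _)); apply: eq_bigr => i _.
exact: linear_fun_sum.
Qed.

Lemma lie_bilin b : is_lie_bracket b -> bilin b.
Proof. by move=> H; split; [exact: lie_linearr|exact: lie_linearl]. Qed.

Lemma lie_antisym b x y : is_lie_bracket b -> b x y = - b y x.
Proof.
move=> H; apply/eqP; rewrite -addr_eq0.
have E z w w' : b z (w + w') = b z w + b z w'.
  by rewrite -[w]scale1r (lie_linearr H) !scale1r.
have E' z w w' : b (w + w') z = b w z + b w' z.
  by have := lie_linearl H z 1 w w'; rewrite !scale1r.
by have := lie_alt H (x + y); rewrite E !E' !(lie_alt H) add0r addr0 addrC => ->.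
Qed.

Lemma bilin_lin2 b1 b2 (c d : k) : bilin b1 -> bilin b2 ->
  bilin (fun x y => c *: b1 x y + d *: b2 x y).
Proof.
move=> [r1 l1] [r2 l2]; split=> [x a y z|y a x z].
  by rewrite r1 r2 !scalerDr !scalerA ![_ * a]mulrC addrACA.
have /= -> := l1 y a x z; have /= -> := l2 y a x z.
by rewrite !scalerDr !scalerA ![_ * a]mulrC addrACA.
Qed.

(** [mem_stab] asks for a Lie bracket; this form serves the brackets [brt t], for which [brt_bilin]
    supplies bilinearity. *)
Lemma mem_stab_bilin b xi x : bilin b ->
  reflect (forall y, xi (b x y) = 0) (x \in stab b xi).
Proof.
move=> [br_ bl].
have inE' z : linfun (fun y => xi (b z y) : k^o) =1 (fun y => xi (b z y)).
  by apply: linfunE => a u v; rewrite br_ linearP.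
have outE : linfun (fun z => linfun (fun y => xi (b z y)) : dualv q) =1
            (fun z => linfun (fun y => xi (b z y))).
  apply: linfunE => a u v; apply/lfunP => y.
  by rewrite !lfunE /= !lfunE /= !inE' bl linearP.
rewrite memv_ker outE; apply: (iffP eqP) => [x0 y | x0].
  by rewrite -inE' x0 zero_lfunE.
by apply/lfunP => y; rewrite inE' x0 zero_lfunE.
Qed.

(** Each inequality comes from a spanning family: the vectors decoded from a row basis of [N], and
    the rows that encode a basis of the subspace. *)
Lemma dim_vsof (N : 'M[k]_n) : \dim (passmx.vsof e N) = \rank N.
Proof.
apply/eqP; rewrite eqn_leq; apply/andP; split.
  pose X := [seq passmx.vecof e (row i (row_base N)) | i <- enum 'I_(\rank N)].
  apply: (@leq_trans (\dim <<X>>)); last first.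
    by apply: leq_trans (dim_span X) _; rewrite size_map size_enum_ord.
  apply/dimvS/subvP => x; rewrite -passmx.rVof_sub ?e_basis //.
  rewrite -(eq_row_base N) => /submxP[a xE].
  rewrite -[x](passmx.rVofK e_basis) xE mulmx_sum_row.
  rewrite (linear_fun_sum _ _ _ (passmx.vecof_linear e)).
  apply: memv_suml => i _.
  rewrite (linear_funZ _ _ (passmx.vecof_linear e)) memvZ // memv_span //.
  by apply/mapP; exists i; rewrite ?mem_enum.
set V := passmx.vsof e N.
pose B := \matrix_(i < \dim V) passmx.rVof e (vbasis V)`_i.
suff /mxrankS : (N <= B)%MS by move/leq_trans; apply; exact: rank_leq_row.
apply/row_subP => i; have vV : passmx.vecof e (row i N) \in V.
  by rewrite -passmx.rVof_sub ?e_basis // passmx.vecofK ?e_basis // row_sub.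
rewrite -[row i N](passmx.vecofK e_basis) (coord_vbasis vV)
  (linear_fun_sum _ _ _ (passmx.rVof_linear e)).
apply: summx_sub => j _.
rewrite (linear_funZ _ _ (passmx.rVof_linear e)) scalemx_sub //.
by have := row_sub j B; rewrite rowK.
Qed.

(** Evaluation at [pt xi] makes an element of the symmetric algebra a function on q^*. *)
Definition pt xi : 'I_n -> k := fun i => xi e`_i.

Lemma lin_pt xi x : (lin x).@[pt xi] = xi x.
Proof.
rewrite [x in RHS](coord_vbasis (memvf x)) /lin (raddf_sum (meval _)) linear_sum.
by apply: eq_bigr => i _; rewrite /= mevalZ mevalXU linearZ.
Qed.

Lemma pt_surj v : exists xi, v = pt xi.
Proof.
pose f x : k^o := (lin x).@[v].
have fE : linfun f =1 f.
  by apply: linfunE => a x y; rewrite /f linearP mevalD mevalZ.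
by exists (linfun f); apply/funext => i; rewrite /pt fE /f lin_basis mevalXU.
Qed.

(* The form [xi([x, y]_b)], i.e. the Poisson tensor at the point [xi]. *)
Definition bmx b xi : 'M[k]_n := \matrix_(i, j) xi (b e`_i e`_j).

(** The differential d_xi F, an element of q, as its row of coordinates. *)
Definition grad F xi : 'rV[k]_n := \row_i (F^`M(i)).@[pt xi].

Lemma bmxE b xi (u w : 'rV[k]_n) : bilin b ->
  (u *m bmx b xi *m w^T) 0 0 = xi (b (passmx.vecof e u) (passmx.vecof e w)).
Proof.
move=> bb; rewrite /passmx.vecof bilin_sum // linear_sum mxE.
under eq_bigr => j _ do rewrite !mxE mulr_suml.
rewrite exchange_big; apply: eq_bigr => i _; rewrite linear_sum.
apply: eq_bigr => j _; rewrite mxE.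
rewrite (linear_funZ _ _ (bb.1 _)) (linear_funZ _ _ (bb.2 _)) !linearZ /=.
by rewrite [RHS]mulrC.
Qed.

Lemma bmx_eq0 b xi (u : 'rV[k]_n) : bilin b ->
  u *m bmx b xi = 0 <-> forall y, xi (b (passmx.vecof e u) y) = 0.
Proof.
move=> bb; split=> [ub0 y|ub0].
  by rewrite -[y](passmx.rVofK e_basis) -bmxE // ub0 mul0mx mxE.
apply/rowP => j; rewrite [RHS]mxE -(ub0 e`_j) -(passmx.vecof_delta e) -bmxE //.
by rewrite trmx_delta -colE [RHS]mxE.
Qed.

Lemma bmx_anti b xi : (forall x y, b x y = - b y x) -> (bmx b xi)^T = - bmx b xi.
Proof. by move=> bA; apply/matrixP => i j; rewrite !mxE bA linearN. Qed.

Lemma rank_bmx b xi : bilin b -> (\rank (bmx b xi) + \dim (stab b xi) = n)%N.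
Proof.
move=> bb; have -> : stab b xi = passmx.vsof e (kermx (bmx b xi)).
  apply/vspaceP => x; rewrite -passmx.rVof_sub ?e_basis //.
  apply/mem_stab_bilin/sub_kermxP => //.
    by move=> H; apply/bmx_eq0; rewrite // passmx.rVofK ?e_basis.
  by move/bmx_eq0 => /(_ bb); rewrite passmx.rVofK ?e_basis.
by rewrite dim_vsof mxrank_ker subnKC // rank_leq_row.
Qed.

Lemma ind_le b xi : (ind b <= \dim (stab b xi))%N.
Proof.
by rewrite /ind; case: ex_minnP => d _; apply; apply/asboolP; exists xi.
Qed.

Lemma ind_attained b : exists xi, \dim (stab b xi) = ind b.
Proof. by rewrite /ind; case: ex_minnP => d /asboolP[xi <-] _; exists xi. Qed.

Lemma pbr_pt b F G xi :
  (pbr b F G).@[pt xi] = (grad F xi *m bmx b xi *m (grad G xi)^T) 0 0.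
Proof.
rewrite /pbr (raddf_sum (meval _)) mxE /=.
under [RHS]eq_bigr => j _ do rewrite !mxE mulr_suml.
rewrite exchange_big; apply: eq_bigr => i _; rewrite (raddf_sum (meval _)).
by apply: eq_bigr => j _; rewrite !mxE /= !mevalM lin_pt mulrAC.
Qed.

(** Bracket [F] with the variables: their differentials are the standard basis rows. *)
Lemma pcenter_grad b F xi : pcenter b F -> grad F xi *m bmx b xi = 0.
Proof.
move=> ZF; apply/rowP => j; have := pbr_pt b F 'X_j xi.
rewrite (ZF 'X_j) meval0 => E; rewrite [RHS]mxE E.
suff -> : grad 'X_j xi = delta_mx 0 j by rewrite trmx_delta -colE [RHS]mxE.
apply/rowP => i; rewrite !mxE mderivX mnm1E mevalZ /=.
have [->|ji] := eqVneq j i; last by rewrite mul0r.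
have -> : (U_(i) - U_(i) = 0)%MM by apply/mnmP => l; rewrite mnmBE subnn mnm0E.
by rewrite mpolyX0 meval1 mulr1.
Qed.

Lemma adact_pt b x F xi : bilin b ->
  (adact b x F).@[pt xi] = xi (b x (passmx.vecof e (grad F xi))).
Proof.
move=> bb; rewrite /adact (raddf_sum (meval _)) /passmx.vecof (linear_fun_sum _ _ _ (bb.1 _)).
rewrite linear_sum; apply: eq_bigr => i _.
by rewrite /= mevalM lin_pt (linear_funZ _ _ (bb.1 _)) linearZ mxE.
Qed.

Lemma pbr_anti b F G : (forall x y, b x y = - b y x) -> pbr b F G = - pbr b G F.
Proof.
move=> bA; rewrite /pbr exchange_big -sumrN; apply: eq_bigr => j _.
by rewrite -sumrN; apply: eq_bigr => i _; rewrite bA linearN mulrN [F^`M(_) * _]mulrC.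
Qed.

Lemma pbr_lin2 b1 b2 (c d : k) F G :
  pbr (fun x y => c *: b1 x y + d *: b2 x y) F G =
  c *: pbr b1 F G + d *: pbr b2 F G.
Proof.
rewrite /pbr !scaler_sumr -big_split; apply: eq_bigr => i _.
rewrite !scaler_sumr -big_split; apply: eq_bigr => j _ /=.
by rewrite linearD !linearZ mulrDr -!scalerAr.
Qed.

Lemma pcommutator_subalg b F : is_subalg [set G | pbr b G F = 0].
Proof.
split=> /=.
- rewrite /pbr big1 // => i _; apply: big1 => j _.
  by rewrite -[1]/(1%:MP) mderivC !mul0r.
- move=> G H G0 H0; rewrite -[RHS]addr0 -{1}G0 -{1}H0 /pbr -big_split.
  apply: eq_bigr => i _; rewrite -big_split; apply: eq_bigr => j _ /=.
  by rewrite mderivD !mulrDl.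
- move=> c G G0; rewrite -[RHS](scaler0 _ c) -{1}G0 /pbr scaler_sumr.
  apply: eq_bigr => i _; rewrite scaler_sumr; apply: eq_bigr => j _.
  by rewrite mderivZ -!scalerAl.
- move=> G H G0 H0.
  transitivity (H * pbr b G F + G * pbr b H F); last by rewrite G0 H0 !mulr0 addr0.
  rewrite /pbr !mulr_sumr -big_split; apply: eq_bigr => i _.
  rewrite !mulr_sumr -big_split; apply: eq_bigr => j _ /=.
  by rewrite mderivM; ring.
Qed.

Lemma gen_alg_subalg (A : set (symalg q)) : is_subalg (gen_alg A).
Proof.
split.
- by move=> B [[B1]].
- move=> F G FA GA B BP; have [[_ BD _ _] _] := BP.
  by apply: BD; [exact: FA|exact: GA].
- move=> c F FA B BP; have [[_ _ BZ _] _] := BP.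
  by apply: BZ; exact: FA.
- move=> F G FA GA B BP; have [[_ _ _ BM] _] := BP.
  by apply: BM; [exact: FA|exact: GA].
Qed.

(** The Leibniz rule is applied twice: it extends commutation from generators to one generated
    argument, then to both. *)
Lemma gen_alg_pcommutative b (A : set (symalg q)) :
    (forall x y, b x y = - b y x) -> pcommutative b A -> pcommutative b (gen_alg A).
Proof.
move=> bA Acom; have step F : A F -> forall G, gen_alg A G -> pbr b G F = 0.
  move=> AF G; apply: (smallest_sub (pcommutator_subalg b F)) => H AH.
  exact: Acom.
move=> F G FA GA; apply: (smallest_sub (pcommutator_subalg b G) _ FA) => H AH /=.
by rewrite pbr_anti // (step _ AH) ?oppr0.
Qed.

Lemma has_indep_family0 (A : set (symalg q)) : has_indep_family A 0.
Proof.
exists [tuple]; split=> [[]//|P P0].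
have PE : P = (P@_0%MM)%:MP.
  apply/mpolyP => m; rewrite mcoeffC.
  have -> : m = 0%MM by apply/mnmP => -[].
  by rewrite eqxx mulr1.
move: P0; rewrite PE comp_mpolyC => /(congr1 (mcoeff 0%MM)).
by rewrite mcoeffC eqxx mulr1 mcoeff0 => ->.
Qed.

Lemma is_trdeg_bounded (A : set (symalg q)) N :
    (forall r, has_indep_family A r -> (r <= N)%N) ->
  exists d, is_trdeg A d /\ (d <= N)%N.
Proof.
move=> A_le; pose P r := `[< has_indep_family A r >].
have P0 : exists r, P r by exists 0%N; apply/asboolP; exact: has_indep_family0.
have P_le r : P r -> (r <= N)%N by move/asboolP/A_le.
have [d /asboolP dA d_max] := ex_maxnP P0 P_le.
exists d; split; last exact: A_le.
by split=> // r rA; apply: d_max; apply/asboolP.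
Qed.

End Brackets.

(** * Generic isotropy in the pencil, and the bound on independent families *)

(* [W] is [0] when the [Z_t] are considered, and spans [q_0] for the invariants of
   [Z_oo]. *)
Section PencilCommutation.
Variables (k : closedFieldType) (chark : [pchar k] =i pred0) (q : vectType k).
Variables (br : q -> q -> q).
Local Notation n := (\dim {:q}).

Variables (b : q -> q -> q) (p : nat) (W : 'M[k]_(p, n)) (xi0 : dualv q).
Hypothesis b_anti : forall x y, b x y = - b y x.
Hypothesis rank_ge :
  (n <= \rank (row_mx (bmx b xi0) (bmx br xi0 *m W^T)) + ind br)%N.

(** The left kernel of this matrix consists of the [u] in the kernel of the form of [b] that are
    orthogonal to [W] for the form of [br]. The entries are linear in [xi], so the bound at [xi0]
    extends to generic points. *)
Lemma rank_row_bmx_generic : exists2 h : symalg q, h != 0 &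
  forall xi, h.@[pt xi] != 0 ->
    (n <= \rank (row_mx (bmx b xi) (bmx br xi *m W^T)) + ind br)%N.
Proof.
pose e := vbasis {:q}.
pose N : 'M[symalg q]_(n, n + p) := row_mx (\matrix_(i, j) lin (b e`_i e`_j))
  ((\matrix_(i, j) lin (br e`_i e`_j)) *m map_mx (@mpolyC n k) W^T).
have NE xi : map_mx (meval (pt xi)) N = row_mx (bmx b xi) (bmx br xi *m W^T).
  have bE b' : map_mx (meval (pt xi)) (\matrix_(i, j) lin (b' e`_i e`_j)) = bmx b' xi.
    by apply/matrixP => i j; rewrite !mxE lin_pt.
  rewrite map_row_mx map_mxM !bE; congr (row_mx _ (_ *m _)).
  by apply/matrixP => i j; rewrite !mxE /= mevalC.
have [h h0 hN] := mxrank_eval_generic N (pt xi0).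
exists h => // xi /hN; rewrite !NE => rk; apply: leq_trans rank_ge _.
by rewrite leq_add2r.
Qed.

(** If {F, G} were nonzero, it would be nonzero at some point where the generic rank bound holds,
    against [pencil_isotropic] applied to the differentials there. *)
Lemma pbr_pencil_eq0 (s : seq k) (F G : symalg q) :
    (forall xi, W *m bmx b xi = 0) ->
    (forall xi t, t \notin s -> (\rank (bmx b xi + t *: bmx br xi)%R + ind br <= n)%N) ->
    pcenter b F -> pcenter b G -> (forall xi, grad F xi *m bmx br xi *m W^T = 0) ->
  pbr br F G = 0.
Proof.
move=> Wb rank_le ZF ZG FW; apply/eqP/negPn/negP => FG0.
have [h h0 h_rank] := rank_row_bmx_generic.
have [v] := mpoly_neq0_eval chark (mulf_neq0 h0 FG0).
have [xi ->] := pt_surj v; rewrite mevalM mulf_eq0 negb_or => /andP[/h_rank rk].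
rewrite pbr_pt (pencil_isotropic chark (bmx_anti _ b_anti) (Wb xi) (rank_le xi) rk).
- by rewrite mxE eqxx.
- exact: pcenter_grad.
- exact: FW.
- exact: pcenter_grad.
Qed.

(** At a generic point the differentials are linearly independent and lie in a left kernel of
    dimension at most [ind br]. *)
Lemma alg_indep_le_ind r (F : r.-tuple (symalg q)) :
    alg_indep F -> (forall i, pcenter b (tnth F i)) ->
    (forall i xi, grad (tnth F i) xi *m bmx br xi *m W^T = 0) ->
  (r <= ind br)%N.
Proof.
move=> indepF ZF FW; have [h h0 h_rank] := rank_row_bmx_generic.
have [v] := alg_indep_jacobian chark indepF h0.
have [xi ->] := pt_surj v => /h_rank rk; set J := (X in row_free X) => Jfree.
have /mulmx0_rank_max : J *m row_mx (bmx b xi) (bmx br xi *m W^T) = 0.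
  apply/row_matrixP => i; rewrite row_mul row0 mul_mx_row mulmxA.
  have -> : row i J = grad (tnth F i) xi by apply/rowP => j; rewrite !mxE.
  by rewrite FW pcenter_grad ?row_mx0.
by rewrite (eqP Jfree); lia.
Qed.

End PencilCommutation.

(** * The grading by [theta] and the pencil of brackets on q *)

Section CyclicGrading.
Variables (k : closedFieldType) (chark : [pchar k] =i pred0) (q : vectType k).
Variables (br : q -> q -> q) (lie_br : is_lie_bracket br).
Variables (m : nat) (m_ge2 : (2 <= m)%N) (theta : 'End(q)).
Hypothesis theta_aut : is_lie_aut br theta.
Hypothesis theta_ord : has_order theta m.
Variables (zeta : k) (zeta_prim : m.-primitive_root zeta).

Local Notation n := (\dim {:q}).
Local Notation e := (vbasis {:q}).
Local Notation grade := (grade theta zeta).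
Local Notation gcomp := (gcomp theta zeta).
Local Notation br0 := (br0 br theta m zeta).
Local Notation brinf := (brinf br theta m zeta).
Local Notation brt := (brt br theta m zeta).

Let m_gt0 : (0 < m)%N := ltnW m_ge2.

Lemma zeta_neq0 : zeta != 0.
Proof.
apply/eqP => z0; have /eqP := prim_expr_order zeta_prim.
by rewrite z0 expr0n gtn_eqF // eq_sym oner_eq0.
Qed.

(* The component of [x] of degree [l] is the average of [zeta^(-l j) theta^j x]. *)
Lemma grade_full : (\sum_(l < m) grade l)%VS = fullv.
Proof.
apply/eqP; rewrite eqEsubv subvf; apply/subvP => x _.
pose avg l := \sum_(j < m) zeta ^- (l * j) *: iter j theta x.
have avgE : x = m%:R^-1 *: \sum_(l < m) avg l.
  rewrite exchange_big (bigD1 (Ordinal m_gt0)) //= [X in _ + X]big1 => [|j j0].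
    rewrite addr0 (eq_bigr (fun=> x)) => [|l _]; last by rewrite muln0 invr1 scale1r.
    rewrite sumr_const card_ord -scaler_nat scalerA mulVf ?scale1r //.
    by rewrite (iffLR (pcharf0P k) chark) -lt0n.
  rewrite -scaler_suml; set S := \sum_(l < m) _.
  suff -> : S = 0 by rewrite scale0r.
  (* [S] is a geometric sum whose ratio is an [m]-th root of unity other than 1. *)
  have w1 : zeta ^- j - 1 != 0.
    rewrite subr_eq0 invr_eq1 -(expr0 zeta) (eq_prim_root_expr zeta_prim).
    by rewrite mod0n modn_small.
  apply: (mulfI w1); rewrite mulr0 /S.
  rewrite (eq_bigr (fun l : 'I_m => (zeta ^- j) ^+ l)) => [|l _].
    rewrite -subrX1 exprVn -exprM mulnC exprM (prim_expr_order zeta_prim).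
    by rewrite expr1n invr1 subrr.
  by rewrite exprVn -exprM mulnC.
rewrite avgE memvZ // memv_sumr // => l _; rewrite mem_grade; apply/eqP.
pose g j := zeta ^- (l * j) *: iter j theta x.
have [_ theta_m _] := theta_ord; have gm : g m = g 0%N.
  rewrite /g theta_m muln0 mulnC exprM (prim_expr_order zeta_prim).
  by rewrite expr1n expr0.
have g_shift (M : nat) : g M = g 0%N ->
    \sum_(0 <= j < M) g j.+1 = \sum_(0 <= j < M) g j.
  case: M => [|M] gM; first by rewrite !big_nil.
  by rewrite big_nat_recr //= big_nat_recl //= addrC gM.
rewrite /avg -(big_mkord xpredT g) linear_sum -[in RHS](g_shift m) // scaler_sumr.
apply: eq_bigr => j _; rewrite /g linearZ scalerA; congr (_ *: _).
by rewrite mulnS exprD invfM mulrA mulfV ?mul1r // expf_neq0 // zeta_neq0.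
Qed.

Lemma gcomp_sum x : \sum_(i < m) gcomp i x = x.
Proof. by apply: (sumv_pi_sum erefl); rewrite grade_full memvf. Qed.

Lemma gcomp_mem (i : 'I_m) x : gcomp i x \in grade i.
Proof. exact: memv_sum_pi. Qed.

Lemma bilin_grade_ext b1 b2 : bilin b1 -> bilin b2 ->
    (forall (i j : 'I_m) x y, x \in grade i -> y \in grade j -> b1 x y = b2 x y) ->
  b1 =2 b2.
Proof.
move=> bb1 bb2 E x y; rewrite -[x]gcomp_sum -[y]gcomp_sum !bilin_sum //.
by apply: eq_bigr => i _; apply: eq_bigr => j _; apply: E; exact: gcomp_mem.
Qed.

Lemma br_grade (i j l : 'I_m) x y : x \in grade i -> y \in grade j ->
  i + j = l %[mod m] -> br x y \in grade l.
Proof.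
have [bbr bbl] := lie_bilin lie_br.
rewrite !mem_grade theta_aut.2 => /eqP -> /eqP -> ijl.
rewrite (linear_funZ _ _ (bbr _)) (linear_funZ _ _ (bbl _)) scalerA.
rewrite -exprD addnC; apply/eqP; congr (_ *: _); apply/eqP.
by rewrite (eq_prim_root_expr zeta_prim) ijl.
Qed.

Lemma br0_bilin : bilin br0.
Proof.
have [bbr bbl] := lie_bilin lie_br.
split=> [x a y z|y a x z]; rewrite /br0 scaler_sumr -big_split;
  apply: eq_bigr => i _; rewrite scaler_sumr -big_split; apply: eq_bigr => j _ /=.
- by rewrite /gcomp linearP bbr.
- by rewrite /gcomp linearP; apply: bbl.
Qed.

Lemma br0_grade (i j : 'I_m) x y : x \in grade i -> y \in grade j ->
  br0 x y = if (i + j < m)%N then br x y else 0.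
Proof.
move=> xi yj; rewrite (br0E chark lie_br theta_ord zeta_prim xi yj).
by congr (if _ then _ else _); apply/idP/idP; have := m_gt0; lia.
Qed.

Lemma br0_anti x y : br0 x y = - br0 y x.
Proof.
rewrite /br0 -sumrN; under [LHS]eq_bigr => i _ do rewrite big_mkcond.
rewrite exchange_big; apply: eq_bigr => j _ /=.
rewrite -sumrN [RHS]big_mkcond; apply: eq_bigr => i _ /=.
by rewrite addnC; case: ifP => // _; exact: lie_antisym.
Qed.

Lemma brt_bilin t : bilin (brt t).
Proof.
have bb0 := br0_bilin; have bb := lie_bilin lie_br.
have bbinf : bilin brinf.
  have -> : brinf = fun x y => (-1) *: br0 x y + 1 *: br x y.
    by apply/funext => x; apply/funext => y; rewrite scaleN1r scale1r addrC.
  exact: bilin_lin2.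
case: t => [c|] //.
have -> : brt (Some c) = fun x y => 1 *: br0 x y + c *: brinf x y.
  by apply/funext => x; apply/funext => y; rewrite scale1r.
exact: bilin_lin2.
Qed.

Lemma brinf_anti x y : brinf x y = - brinf y x.
Proof. by rewrite /brinf opprB br0_anti (lie_antisym _ _ lie_br) opprK addrC. Qed.

Lemma brt_anti t x y : brt t x y = - brt t y x.
Proof.
case: t => [c|]; last exact: brinf_anti.
by rewrite /brt br0_anti brinf_anti scalerN opprD.
Qed.

(* For [s != 0] this is an isomorphism from [q_(s^m)] onto [q], see [gscale_br]. *)
Definition gscale (s : k) x : q := \sum_(i < m) s ^+ i *: gcomp i x.

Lemma gscale_linear s : linear (gscale s).
Proof.
move=> a x y; rewrite /gscale scaler_sumr -big_split; apply: eq_bigr => i _ /=.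
by rewrite /gcomp linearP scalerDr !scalerA mulrC.
Qed.

Lemma gscale_grade s (i : 'I_m) x : x \in grade i -> gscale s x = s ^+ i *: x.
Proof.
move=> xi; rewrite /gscale (bigD1 i) //= big1 => [|j ji].
  by rewrite (gcomp_grade _ chark theta_ord zeta_prim xi) eqxx addr0.
by rewrite (gcomp_grade _ chark theta_ord zeta_prim xi) (negPf ji) scaler0.
Qed.

Lemma gscaleK s : s != 0 -> cancel (gscale s) (gscale s^-1).
Proof.
move=> s0 x; rewrite [gscale s x]/gscale (linear_fun_sum _ _ _ (gscale_linear _)).
rewrite -[RHS]gcomp_sum; apply: eq_bigr => i _.
rewrite (gscale_grade _ (i := i)) ?memvZ ?gcomp_mem //.
by rewrite scalerA -exprMn mulVf // expr1n scale1r.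
Qed.

(** For degrees [i] and [j] the left side carries [s ^+ (i + j)]. If [i + j >= m] the bracket lies
    in degree [i + j - m], and the coefficient [s ^+ m] makes up the difference. *)
Lemma gscale_br s x y :
  br (gscale s x) (gscale s y) = gscale s (br0 x y + s ^+ m *: brinf x y).
Proof.
have [bbr bbl] := lie_bilin lie_br; have [ggr ggl] := brt_bilin (Some (s ^+ m)).
apply: (bilin_grade_ext (b1 := fun x y => br (gscale s x) (gscale s y))
  (b2 := fun x y => gscale s (brt (Some (s ^+ m)) x y))).
- split=> [u a v w|u a v w]; first by rewrite gscale_linear bbr.
  by rewrite gscale_linear; apply: bbl.
- split=> [u a v w|u a v w]; first by rewrite ggr gscale_linear.
  by have /= -> := ggl u a v w; rewrite gscale_linear.
move=> i j u v ui vj; rewrite (gscale_grade s ui) (gscale_grade s vj).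
rewrite (linear_funZ _ _ (bbr _)) (linear_funZ _ _ (bbl _)) scalerA -exprD addnC.
rewrite /brt /brinf (br0_grade ui vj); case: ltnP => ij.
  rewrite subrr scaler0 addr0 (gscale_grade s (i := Ordinal ij)) //.
  exact: br_grade ui vj _.
have ijm : (i + j - m < m)%N by have := ltn_ord i; have := ltn_ord j; lia.
rewrite subr0 add0r (linear_funZ _ _ (gscale_linear s)).
rewrite (gscale_grade s (i := Ordinal ijm)); last first.
  by apply: br_grade ui vj _; rewrite /= -{1}(subnK ij) modnDr.
by rewrite scalerA -exprD /= subnKC.
Qed.

(** Take [s] with [s ^+ m = d / c], which exists as [k] is algebraically closed: the bracket is then
    [c] times the transport of [br] by [gscale s], so its stabilizers have dimension at least
    [ind br]. *)
Lemma rank_bmx_pencil (c d : k) xi : c != 0 -> d != 0 ->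
  (\rank (bmx (fun x y => c *: br0 x y + d *: brinf x y)%R xi) + ind br <= n)%N.
Proof.
move=> c0 d0; set b := fun x y => _.
have bb : bilin b by apply: bilin_lin2; [exact: br0_bilin|exact: (brt_bilin None)].
have [s sm] : exists s : k, s ^+ m = d / c.
  have /closed_rootP[s] : size ('X^m - (d / c)%:P : {poly k}) != 1%N.
    by rewrite size_XnsubC // eqSS -lt0n.
  by rewrite /root !hornerE subr_eq0 => /eqP; exists s.
have s0 : s != 0.
  apply: contraTneq (mulf_neq0 d0 (invr_neq0 c0)) => sE.
  by rewrite -sm sE expr0n gtn_eqF // eqxx.
have bE x y : b x y = c *: gscale s^-1 (br (gscale s x) (gscale s y)).
  rewrite gscale_br gscaleK // sm scalerDr scalerA mulrC divfK //.
pose g : 'End(q) := linfun (gscale s^-1); have gE := linfunE (gscale_linear s^-1).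
have gK y : gscale s (g y) = y.
  by rewrite gE -{1}[s]invrK gscaleK // invr_eq0.
apply: leq_trans (eq_leq (rank_bmx xi bb)); rewrite leq_add2l.
apply: leq_trans (ind_le br (xi \o g)%VF) _; rewrite -(limg_dim_eq (f := g)); last first.
  apply/eqP; rewrite -subv0; apply/subvP => y; rewrite memv_cap memv_ker memv0.
  case/andP=> _ /eqP gy; rewrite -[y]gK gy; apply/eqP.
  exact: linear_fun0 (gscale_linear s).
apply/dimvS/subvP => _ /memv_imgP[y /(mem_stab_bilin _ _ (lie_bilin lie_br)) yst ->].
apply/mem_stab_bilin => // z; rewrite bE linearZ gK.
by have := yst (gscale s z); rewrite comp_lfunE gE /= => ->; rewrite scaler0.
Qed.

(** As [br] is the sum of [br0] and [brinf], each member is a combination of these two; [s] lists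
    the two values of [u] at which one of its coefficients vanishes. *)
Lemma rank_brt_pencil t : exists s : seq k, forall xi u, u \notin s ->
  (\rank (bmx (brt t) xi + u *: bmx br xi)%R + ind br <= n)%N.
Proof.
pose cd u := if t is Some c then (1 + u, c + u) else (u, 1 + u).
exists (if t is Some c then [:: -1; - c] else [:: 0; -1]) => xi u us.
have -> : bmx (brt t) xi + u *: bmx br xi =
    bmx (fun x y => (cd u).1 *: br0 x y + (cd u).2 *: brinf x y) xi.
  apply/matrixP => i j; rewrite !mxE.
  transitivity (xi (brt t e`_i e`_j + u *: br e`_i e`_j)).
    by rewrite linearD linearZ.
  congr (xi _).
  have -> : br e`_i e`_j = br0 e`_i e`_j + brinf e`_i e`_j by rewrite addrC subrK.
  case: (t) @cd us => [c|] cd us /=; move: (br0 _ _) (brinf _ _) => v w;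
    rewrite scalerDr !scalerDl ?scale1r.
    by rewrite addrACA.
  by rewrite addrCA.
suff [c0 d0] : (cd u).1 != 0 /\ (cd u).2 != 0 by exact: rank_bmx_pencil.
case: (t) @cd us => [c|] /=; rewrite !inE negb_or => /andP[u1 u2]; split=> //.
- by rewrite addrC addr_eq0.
- by rewrite addrC addr_eq0.
- by rewrite addrC addr_eq0.
Qed.

(** The scalars are homogeneous coordinates of [t] on the projective line. *)
Lemma pbr_brt t F G : pbr (brt t) F G =
  (if t is Some _ then 1 else 0) *: pbr br0 F G +
  (if t is Some c then c else 1) *: pbr brinf F G.
Proof.
rewrite -pbr_lin2; congr (pbr _ F G); apply/funext => x; apply/funext => y.
by case: t => [c|] /=; rewrite scale1r // scale0r add0r.
Qed.

(** Two distinct points of the projective line give two independent linear relations between {F,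
    G}_0 and {F, G}_oo. *)
Lemma pbr_Zt_distinct t t' F G : t <> t' ->
  Zt br theta m zeta t F -> Zt br theta m zeta t' G -> pbr br F G = 0.
Proof.
move=> tt' /(_ G); rewrite pbr_brt => FG /(_ F).
rewrite (pbr_anti _ _ (brt_anti _)) => /eqP; rewrite oppr_eq0 pbr_brt => /eqP.
have -> : pbr br F G = pbr br0 F G + pbr brinf F G.
  rewrite -[pbr br0 F G]scale1r -[pbr brinf F G]scale1r -pbr_lin2.
  congr (pbr _ F G); apply/funext => x; apply/funext => y.
  by rewrite !scale1r addrC subrK.
move: FG; move: (pbr br0 F G) (pbr brinf F G) => u v.
case: t t' tt' => [c|] [c'|] tt'; rewrite ?scale1r ?scale0r ?add0r //.
- move=> /eqP uc /eqP uc'; move: uc uc'; rewrite !addr_eq0 => /eqP -> /eqP.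
  move/oppr_inj/eqP; rewrite -subr_eq0 -scalerBl scaler_eq0 subr_eq0.
  case/orP=> [/eqP cc'|/eqP ->]; first by case: tt'; rewrite cc'.
  by rewrite scaler0 oppr0 addr0.
- by move=> + v0; rewrite v0 scaler0 addr0.
- by move=> v0; rewrite v0 scaler0 addr0.
Qed.

(** Here [W] has no rows, and the rank condition holds at a form [xi0] with stabilizer of dimension
    [ind (brt t) = ind br]. *)
Lemma pbr_Zt t F G : Preg br theta m zeta t ->
  Zt br theta m zeta t F -> Zt br theta m zeta t G -> pbr br F G = 0.
Proof.
rewrite /Preg /= => t_reg ZF ZG.
have [xi0 xi0E] := ind_attained (brt t).
have [s rank_le] := rank_brt_pencil t.
apply: (pbr_pencil_eq0 chark (W := 0 : 'M_(0, n)) (xi0 := xi0)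
  (brt_anti t) _ _ rank_le ZF ZG) => [|xi|xi]; last 2 first.
- by rewrite mul0mx.
- by rewrite trmx0 mulmx0.
rewrite trmx0 mulmx0 rank_row_mx0 -t_reg -xi0E.
by rewrite rank_bmx //; exact: brt_bilin.
Qed.

Definition q0_mx := passmx.msof e (passmx.leigenspace theta 1).

Let i0 : 'I_m := Ordinal m_gt0.

Lemma grade0E : passmx.leigenspace theta 1 = grade i0.
Proof. by rewrite /grade expr0. Qed.

(** Degrees 0 and [j < m] never add up to [m], so q_0 is central for [brinf]. *)
Lemma q0_mx_brinf xi : q0_mx *m bmx brinf xi = 0.
Proof.
apply/row_matrixP => i; rewrite row_mul row0.
apply/(bmx_eq0 _ _ (brt_bilin None)) => y.
have ui : passmx.vecof e (row i q0_mx) \in grade i0.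
  by rewrite -grade0E passmx.mem_vecof ?vbasisP // row_sub.
rewrite -[y]gcomp_sum (linear_fun_sum _ _ _ ((brt_bilin None).1 _)) linear_sum.
apply: big1 => j _ /=; rewrite /brinf (br0_grade ui (gcomp_mem j y)) /= ltn_ord.
by rewrite subrr linear0.
Qed.

(** Invariance under x in q_0 reads xi([x, d_xi F]) = 0 at [xi]; antisymmetry moves x to the
    right. *)
Lemma grad_Zinf_inv F xi : Zinf_inv br theta m zeta F ->
  grad F xi *m bmx br xi *m q0_mx^T = 0.
Proof.
case=> _ F_inv; apply: trmx_inj; rewrite trmx0 trmx_mul trmxK.
apply/row_matrixP => i; rewrite row_mul row0.
have bb := lie_bilin lie_br.
have ui : passmx.vecof e (row i q0_mx) \in passmx.leigenspace theta 1.
  by rewrite passmx.mem_vecof ?vbasisP // row_sub.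
apply/rowP => j; rewrite ord1 [RHS]mxE trmx_mul.
rewrite (bmx_anti _ (fun x y => lie_antisym x y lie_br)).
rewrite mulNmx mulmxN mxE mulmxA (bmxE _ _ _ bb) -adact_pt //.
by rewrite F_inv // meval0 oppr0.
Qed.

(* At [xi] in [q_0^*], the forms [xi([x, y])] and [xi([x, y]_oo)] agree for [y] in
   [q_i], [i > 0]. *)
Lemma rank_dual0 xi : dual0 theta m zeta xi -> regular br xi ->
  (n <= \rank (row_mx (bmx brinf xi) (bmx br xi *m q0_mx^T)) + ind br)%N.
Proof.
move=> xi_dual0 xi_reg; have bb := lie_bilin lie_br.
have bb0 := br0_bilin; have bbinf := brt_bilin None.
set N := row_mx _ _.
(* By regularity the kernel on the right has dimension [ind br]. *)
suff kerN : (kermx N <= kermx (bmx br xi))%MS.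
  have := mxrankS kerN; rewrite !mxrank_ker -xi_reg.
  by have := rank_bmx xi bb; have := rank_leq_row N; lia.
apply/row_subP => i; set u := row i _.
have : u *m N = 0 by rewrite -row_mul mulmx_ker row0.
rewrite mul_mx_row mulmxA -(row_mx0 _ _ _ _) => /eq_row_mx[uinf u0].
apply/sub_kermxP/(bmx_eq0 _ _ bb) => y.
rewrite -[y]gcomp_sum (linear_fun_sum _ _ _ (bb.1 _)) linear_sum.
apply: big1 => j _ /=; set x := passmx.vecof e u; set z := gcomp j y.
(* In degree 0, [u0] says that [x] is orthogonal to q_0. *)
have [j0|j_gt0] := posnP j.
  have /submxP[a aE] : (passmx.rVof e z <= q0_mx)%MS.
    rewrite -passmx.mem_vecof ?vbasisP // passmx.rVofK ?vbasisP // grade0E.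
    have -> : i0 = j by apply: val_inj; rewrite /= j0.
    exact: gcomp_mem.
  rewrite -[z](passmx.rVofK (vbasisP _)) aE /x -(bmxE _ _ _ bb).
  by rewrite trmx_mul mulmxA u0 mul0mx mxE.
(* The terms of [br0 x z] have degrees [l + j] with [0 < l + j < m], and [xi] vanishes there. *)
have xi0 : xi (br0 x z) = 0.
  rewrite -[x]gcomp_sum (linear_fun_sum _ _ _ (bb0.2 z)) linear_sum.
  apply: big1 => l _ /=; rewrite (br0_grade (gcomp_mem l x) (gcomp_mem j y)).
  case: ltnP => lj; last by rewrite linear0.
  apply: (xi_dual0 (Ordinal lj)); first by rewrite addn_gt0 j_gt0 orbT.
  exact: br_grade (gcomp_mem l x) (gcomp_mem j y) _.
have := (bmx_eq0 xi u bbinf).1 uinf z; rewrite -/x linearB /= xi0 subr0.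
exact.
Qed.

End CyclicGrading.

(** * Commutativity and transcendence degree for the invariants *)

Theorem theorem2p3 (k : closedFieldType) (chark : [pchar k] =i pred0)
    (q : vectType k) (br : q -> q -> q)
    (lie_br : is_lie_bracket br) (alg_br : is_algebraic br)
    (m : nat) (m_ge2 : (2 <= m)%N) (theta : 'End(q))
    (theta_aut : is_lie_aut br theta) (theta_ord : has_order theta m)
    (zeta : k) (zeta_prim : m.-primitive_root zeta)
    (reg0 : dual0 theta m zeta `&` regular br !=set0) :
  [/\ pcommutative br (Zinf_inv br theta m zeta),
      pcommutative br
        (gen_alg (Zalg br theta m zeta `|` Zinf_inv br theta m zeta)) &
      exists d : nat,
        is_trdeg (Zinf_inv br theta m zeta) d /\ (d <= ind br)%N].
Proof.
have [xi0 [xi0_dual0 xi0_reg]] := reg0.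
have rank0 := rank_dual0 chark lie_br m_ge2 theta_aut theta_ord zeta_prim
  xi0_dual0 xi0_reg.
have brinf_a x y : brinf br theta m zeta x y = - brinf br theta m zeta y x.
  exact: brinf_anti.
have br_a x y := lie_antisym x y lie_br.
have inv_com : pcommutative br (Zinf_inv br theta m zeta).
  move=> F G ZF ZG.
  have [s rank_le] := rank_brt_pencil chark lie_br m_ge2 theta_aut theta_ord
    zeta_prim None.
  apply: (pbr_pencil_eq0 chark brinf_a rank0 _ rank_le ZF.1 ZG.1) => xi.
    exact: (q0_mx_brinf chark lie_br m_ge2 theta_ord zeta_prim).
  exact: (grad_Zinf_inv lie_br xi ZF).
split=> //.
  have gen_com : pcommutative br
      (\bigcup_(t in Preg br theta m zeta) Zt br theta m zeta t `|`
       Zinf_inv br theta m zeta).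
    (* With [t' = None] this also covers an element of [Zt] against an invariant, since the
       invariants lie in the Poisson centre at infinity. *)
    have Zt_com t t' F G : Preg br theta m zeta t -> Zt br theta m zeta t F ->
        Zt br theta m zeta t' G -> pbr br F G = 0.
      move=> tP ZF ZG; have [tt'|tt'] := eqVneq t t'; last first.
        by apply: (pbr_Zt_distinct lie_br _ ZF ZG); exact/eqP.
      apply: (pbr_Zt chark lie_br m_ge2 theta_aut theta_ord zeta_prim tP ZF).
      by rewrite tt'.
    move=> F G [[t tP ZF]|ZF] [[t' t'P ZG]|ZG].
    - exact: Zt_com ZF ZG.
    - exact: Zt_com ZF ZG.1.
    - by rewrite pbr_anti // (Zt_com _ _ _ _ t'P ZG ZF.1) oppr0.
    - exact: inv_com.
  set A := _ `|` _ in gen_com.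
  (* [Zalg] is itself generated by the centres, so these and the invariants generate the whole
     algebra. *)
  have sub_gen : gen_alg (Zalg br theta m zeta `|` Zinf_inv br theta m zeta) `<=`
      gen_alg A.
    apply: smallest_sub => [|F [ZF|ZF]]; first exact: gen_alg_subalg.
      apply: smallest_sub ZF; first exact: gen_alg_subalg.
      by move=> G GZ; apply: sub_gen_smallest; left.
    by apply: sub_gen_smallest; right.
  by move=> F G /sub_gen FA /sub_gen GA; apply: (gen_alg_pcommutative br_a gen_com).
apply: is_trdeg_bounded => r [F [FZ indepF]].
apply: (alg_indep_le_ind chark rank0 indepF) => [i|i xi]; first exact: (FZ i).1.
exact: (grad_Zinf_inv lie_br xi (FZ i)).
Qed.
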